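(* Under the nonparametric regression model and technical assumptions below, fix $x\in\mathcal X$ and let $0<s_1<s_2=o(n)$ with $s_1,s_2\to\infty$ satisfy the bounded-ratio condition. Then the DNN estimator (of order $s=s_1$ or $s=s_2$) and the TDNN estimator satisfy the asymptotic Hájek dominance condition, i.e. $$\frac{s}{n}\left(\frac{\zeta^{s}_{s}(x)}{s\,\zeta^{1}_{s}(x)}-1\right)\to0 \quad\text{and}\quad \frac{s_2}{n}\left(\frac{\zeta^{s_2}_{\mathfrak S}(x)}{s_2\,\zeta^{1}_{\mathfrak S}(x)}-1\right)\to0 .$$
   Context: Data: $D_{[n]}=(Z_1,\dots,Z_n)$ with $Z_i=(X_i,Y_i)$ i.i.d. from the model $Y=\mu(X)+\varepsilon$, where $X\in\mathcal X\subset\mathbb R^k$ ($k$ fixed) has density $f$ and distribution $\varphi$, $\mathbb E[\varepsilon\mid X]=0$ and $\operatorname{Var}(\varepsilon\mid X=x)=\sigma^2_\varepsilon(x)$. Technical assumptions: $\mathcal X$ is a bounded compact subset of $\mathbb R^k$; $0<\underline{\mathfrak f}\le f\le\overline{\mathfrak f}<\infty$ on $\mathcal X$; $f$ and $\mu$ are four times continuously differentiable with bounded second, third and fourth order partial derivatives; $\mu\in L^2(\mathcal X,\varphi)$; $\sigma^2_\varepsilon:\mathcal X\to(0,\infty)$ is continuous, square-integrable w.r.t. $\varphi$, and bounded above by $\overline\sigma^2_\varepsilon$. For a finite data set $D$ containing $Z_i$, $\kappa(x;Z_i,D)=1$ if $X_i$ is the closest covariate in $D$ to $x$ in Euclidean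 norm, and $0$ otherwise (ties have probability zero). With $L_{n,s}$ the set of strictly increasing $s$-tuples from $\{1,\dots,n\}$ and $D_\ell$ the observations indexed by $\ell$, the DNN kernel is $h_s(x;D_\ell)=\sum_{i\in\ell}\kappa(x;Z_i,D_\ell)Y_i$ and the DNN estimator is $\tilde\mu_s(x;D_{[n]})=\binom{n}{s}^{-1}\sum_{\ell\in L_{n,s}}h_s(x;D_\ell)$. For $1\le s_1<s_2\le n$ (write $\mathfrak S=(s_1,s_2)$), let $w_1^*=1/(1-(s_1/s_2)^{-2/k})$, $w_2^*=1-w_1^*$; the TDNN estimator is $\hat\mu_{\mathfrak S}(x;D_{[n]})=w_1^*\tilde\mu_{s_1}(x;D_{[n]})+w_2^*\tilde\mu_{s_2}(x;D_{[n]})=\binom{n}{s_2}^{-1}\sum_{\ell\in L_{n,s_2}}h_{\mathfrak S}(x;D_\ell)$ with kernel $h_{\mathfrak S}(x;D_{[s_2]})=w_1^*\tilde\mu_{s_1}(x;D_{[s_2]})+w_2^*h_{s_2}(x;D_{[s_2]})$. Bounded-ratio condition: there is $\mathfrak c\in(0,1/2)$ with $\mathfrak c\le s_1/s_2\le 1-\mathfrak c$ for all $n$. For a kernel $g$ of order $m$ (here $g=h_s$ with $m=s$, or $g=h_{\mathfrak S}$ with $m=s_2$), $\zeta^1=\operatorname{Cov}(g(x;Z_1,Z_2,\dots,Z_m),g(x;Z_1,Z_2',\dots,Z_m'))$ with $Z_j'$ independent copies, and $\zeta^m=\operatorname{Var}(g(x;Z_1,\dots,Z_m))$. Limits are as $n\to\infty$.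 *)

(* Defs.v *)
From HB Require Import structures.
From mathcomp Require Import all_boot all_order all_algebra.
From mathcomp Require Import all_classical all_reals all_analysis.
Set Implicit Arguments. Unset Strict Implicit. Unset Printing Implicit Defensive.
Import Order.TTheory GRing.Theory Num.Theory.
Import numFieldNormedType.Exports.
Local Open Scope classical_set_scope.
Local Open Scope ring_scope.

Definition rowt (R : realType) (k : nat) (t : k.-tuple R) : 'rV[R]_k :=
  \row_(i < k) tnth t i.

Fixpoint iter_int (R : realType) (n : nat) : (n.-tuple R -> \bar R) -> \bar R :=
  match n return (n.-tuple R -> \bar R) -> \bar R with
  | 0 => fun g => g [tuple]
  | n'.+1 => fun g =>
      (\int[@lebesgue_measure R]_t iter_int (fun u => g (cons_tuple t u)))%E
  end.

Definition pd (R : realType) (k : nat) (i : 'I_k) (g : 'rV[R]_k -> R) : 'rV[R]_k -> R :=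
  fun v => 'D_(delta_mx 0 i) g v.

Definition iid {d d'} {T : measurableType d} {V : measurableType d'} {R : realType}
  (P : probability T R) (Z : nat -> T -> V) : Prop :=
  [/\ (forall i, measurable_fun setT (Z i)),
      (forall (I : seq nat) (A : nat -> set V), uniq I ->
         (forall i, measurable (A i)) ->
         P (\bigcap_(i in [set j | j \in I]) (Z i @^-1` A i)) =
         (\prod_(i <- I) P (Z i @^-1` A i))%E) &
      (forall i (A : set V), measurable A -> P (Z i @^-1` A) = P (Z 0%N @^-1` A))].

Definition pds (R : realType) (k : nat) (s : seq 'I_k) (g : 'rV[R]_k -> R) :
  'rV[R]_k -> R := foldr (@pd R k) g s.

Definition C4_on (R : realType) (k : nat) (U : set 'rV[R]_k) (g : 'rV[R]_k -> R) : Prop :=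
  forall s : seq 'I_k, (size s <= 4)%N -> forall v, U v ->
    {for v, continuous (pds s g)} /\
    ((size s < 4)%N -> forall i : 'I_k, derivable (pds s g) v (delta_mx 0 i)).

Definition bounded_d234_on (R : realType) (k : nat) (S : set 'rV[R]_k) (g : 'rV[R]_k -> R) : Prop :=
  exists M : R, forall s : seq 'I_k, (2 <= size s <= 4)%N ->
    forall v, S v -> `|pds s g v| <= M.

Definition sqdist (R : realType) (k : nat) (x : 'rV[R]_k) (t : k.-tuple R) : R :=
  \sum_(i < k) (tnth t i - x 0 i) ^+ 2.

(* sum over i in A of kappa(x; Z_i, D_A) Y_i : the 1-NN of x among the
   observations indexed by A (strictly closest; ties, of probability 0, give 0) *)
Definition nn_sub (R : realType) (k : nat) (x : 'rV[R]_k) (m : nat) (A : {set 'I_m})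
  (D : nat -> k.-tuple R * R) : R :=
  \sum_(i in A)
    (if [forall j in A, (j != i) ==> (sqdist x (D i).1 < sqdist x (D j).1)]
     then (D i).2 else 0).

Definition dnn_kernel (R : realType) (k : nat) (x : 'rV[R]_k) (s : nat)
  (D : nat -> k.-tuple R * R) : R := nn_sub x [set: 'I_s] D.

Definition tdnn_w1 (R : realType) (k s1 s2 : nat) : R :=
  (1 - ((s1%:R / s2%:R) `^ (- (2 / k%:R))))^-1.

Definition tdnn_kernel (R : realType) (k : nat) (x : 'rV[R]_k) (s1 s2 : nat)
  (D : nat -> k.-tuple R * R) : R :=
  tdnn_w1 R k s1 s2 *
    (('C(s2, s1))%:R^-1 * \sum_(A : {set 'I_s2} | #|A| == s1) nn_sub x A D)
  + (1 - tdnn_w1 R k s1 s2) * dnn_kernel x s2 D.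

(* zeta^1 for a kernel g of order m, computed from an i.i.d. sequence Z:
   Cov(g(Z_0, Z_1, ..., Z_{m-1}), g(Z_0, Z_m, ..., Z_{2m-2})) *)
Definition zeta_1 {d d'} {T : measurableType d} {V : measurableType d'} {R : realType}
  (P : probability T R) (Z : nat -> T -> V) (g : (nat -> V) -> R) (m : nat) : R :=
  fine (covariance P (fun w => g (fun i => Z i w))
                     (fun w => g (fun i => if i == 0%N then Z 0%N w else Z (m + i - 1)%N w))).

Definition zeta_m {d d'} {T : measurableType d} {V : measurableType d'} {R : realType}
  (P : probability T R) (Z : nat -> T -> V) (g : (nat -> V) -> R) : R :=
  fine ('V_P[fun w => g (fun i => Z i w)]).

(* Main.v *)
(** Since s/n -> 0, it suffices that zeta^m stays bounded and that m zeta^1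
    stays bounded away from 0.  Both kernels are mixtures, over subsets A of
    the sample, of the label of the nearest neighbour of x inside A.  Writing
    Y = mu(X) + eps, such a kernel is g = eps_1 a + r, where a is the total
    weight it gives to observation 1 and neither a nor r involves eps_1.
    Because E[eps | X] = 0 and Var(eps | X) = sigma^2(X) >= smin > 0,
      zeta^1 >= E[eps_1^2 a a'] + Cov(r, r') >= smin E[a a'],
    a prime denoting a copy that shares observation 1 only; both inequalities
    use that Cov(h, h') >= 0 for every statistic h, which holds because the
    variance of the mean of N such copies is nonnegative for all N.
    As ties have probability 0, observation 1 is the nearest to x among l
    observations with probability 1/l, so E[a a'] is the explicit sum of
    c_A c_A' / (|A| + |A'| - 1), a positive quadratic form of order 1/m. *)

Require Import Defs.
From HB Require Import structures.
From mathcomp Require Import all_boot all_order all_algebra.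
From mathcomp Require Import all_classical all_reals all_analysis.
From mathcomp Require Import measurable_realfun zify.
From mathcomp Require Import ring lra.
Import Order.TTheory GRing.Theory Num.Theory.
Import numFieldNormedType.Exports.
Local Open Scope classical_set_scope.
Local Open Scope ring_scope.

(** * Weighted integrals determined on a pi-system *)

(** Two obstacles shape the proof. The hypotheses on the noise are integrals over events of the
    covariate alone, while the kernels are functions of the whole sample. The passage is made
    without conditional expectations: two weights on the probability space with the same integral
    over every cylinder of the sequence space define the same measure there, hence integrate every
    nonnegative function of the sequence equally. Applied to sequences whose i-th label has been
    erased, this exchanges the positive and negative parts of eps_i, and also eps_i^2 and
    sigma^2(X_i). The second obstacle is the sign of the TDNN weights: w1 < 0 and w2 > 1, so the
    quadratic form has negative cross terms. Since |A| + |A'| - 1 is the mean of 2|A| - 1 and 2|A'|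
    - 1, completing a square leaves a remainder proportional to the squared difference of the two
    sizes, which the bounded-ratio condition keeps of order 1/m. The same condition bounds w1, hence
    the variance. *)

Section density_measure.
Context {d} {T : measurableType d} {R : realType}.
Variables (P : {measure set T -> \bar R}) (eta : T -> R).
Hypotheses (meta : measurable_fun setT eta) (eta0 : forall w, 0 <= eta w).

(** The two proofs are arguments so that the measure instance declared below can recover them from
    the term by unification. *)
Definition density_measure (_ : measurable_fun setT eta)
  (_ : forall w, 0 <= eta w) (A : set T) : \bar R :=
  (\int[P]_(w in A) (eta w)%:E)%E.

Let nu := density_measure meta eta0.

Let nu0 : nu set0 = 0%E.
Proof. by rewrite /nu /density_measure integral_set0. Qed.

Let nu_ge0 A : (0 <= nu A)%E.
Proof. by apply: integral_ge0 => w _; rewrite lee_fin. Qed.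

Let nu_sigma_additive : semi_sigma_additive nu.
Proof.
apply: semi_sigma_additive_nng_induced => [|w]; last by rewrite lee_fin.
exact/measurable_EFinP.
Qed.

HB.instance Definition _ :=
  isMeasure.Build _ _ _ nu nu0 nu_ge0 nu_sigma_additive.

Definition density_measure_pack : {measure set T -> \bar R} := nu.

End density_measure.

(* Layer cake: Tonelli turns a weighted integral of [phi] into an integral over
   the levels of the weights of the superlevel sets of [phi]. *)
Lemma layer_cake {d} {T : measurableType d} {R : realType}
    (P : probability T R) (eta phi : T -> R) :
  measurable_fun setT eta -> measurable_fun setT phi ->
  (forall w, 0 <= eta w) -> (forall w, 0 <= phi w) ->
  (\int[P]_w (eta w * phi w)%:E =
   \int[@lebesgue_measure R]_t
     (if (0 <= t)%R then \int[P]_(w in [set w | (t < phi w)%R]) (eta w)%:E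
      else 0))%E.
Proof.
move=> meta mphi eta0 phi0.
pose f (z : T * R) : \bar R :=
  (if (0 <= z.2) && (z.2 < phi z.1) then eta z.1 else 0)%:E.
have mf : measurable_fun setT f.
  apply/measurable_EFinP; apply: measurable_fun_ifT => //.
  - apply: measurable_and.
      by apply: measurable_fun_ler => //; exact: measurable_snd.
    apply: measurable_fun_ltr; first exact: measurable_snd.
    by apply: measurableT_comp => //; exact: measurable_fst.
  - by apply: measurableT_comp => //; exact: measurable_fst.
have f0 z : (0 <= f z)%E by rewrite lee_fin; case: ifP.
transitivity (\int[P]_w \int[@lebesgue_measure R]_t f (w, t))%E.
  apply: eq_integral => w _.
  transitivity (\int[@lebesgue_measure R]_t
      ((eta w)%:E * (\1_(`[0, phi w[%classic) t)%:E))%E; last first.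
    apply: eq_integral => t _; rewrite /f/= indicE mem_setE in_itv/=.
    by case: ifP => _; rewrite ?mule1 ?mule0.
  rewrite ge0_integralZl_EFin//; last first.
    by apply/measurable_EFinP; exact: measurable_indic.
  rewrite integral_indic// setIT. 
  rewrite -[X in (_ * X)%E]/(lebesgue_measure `[0, phi w[%classic).
  rewrite lebesgue_measure_itv/= lte_fin.
  rewrite EFinM; case: ltP => [_|phi_le0]; first by rewrite sube0.
  by have -> : phi w = 0 by apply/eqP; rewrite eq_le phi_le0 phi0.
rewrite (@fubini_tonelli _ _ _ _ _ P (@lebesgue_measure R) f mf f0).
apply: eq_integral => t _; case: ifP => t0.
  rewrite [RHS]integral_mkcond; apply: eq_integral => w _.
  rewrite /f/= t0/= patchE; case: ifPn => h; case: ifPn => //.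
    by rewrite notin_setE/=; rewrite h.
  by rewrite inE/= (negbTE h).
by rewrite integral0_eq// => w _; rewrite /f/= t0.
Qed.

Lemma weighted_pushforward_measure {d d'} {T : measurableType d}
    {S : measurableType d'} {R : realType} (P : {measure set T -> \bar R})
    (U : T -> S) (eta : T -> R) :
  measurable_fun setT U -> measurable_fun setT eta ->
  (forall w, 0 <= eta w) ->
  exists m : {measure set S -> \bar R},
    forall A, m A = (\int[P]_(w in U @^-1` A) (eta w)%:E)%E.
Proof.
move=> mU meta eta0.
pose m : {measure set T -> \bar R} := density_measure_pack P eta meta eta0.
by unshelve eexists (pushforward m U : {measure set S -> \bar R}).
Qed.

(** Both weighted push-forwards are measures on [S] that agree on a generating pi-system. The first
    has finite total mass and [G setT] holds, so they coincide, and the layer cake formula carries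
    the equality from superlevel sets to functions. *)
Lemma weighted_pushforward_eq {d d'} {T : measurableType d}
    {S : measurableType d'} {R : realType} (P : probability T R)
    (G : set (set S)) (U U' : T -> S) (eta eta' : T -> R) :
  measurable = <<s G >> -> setI_closed G -> G setT ->
  measurable_fun setT U -> measurable_fun setT U' ->
  measurable_fun setT eta -> measurable_fun setT eta' ->
  (forall w, 0 <= eta w) -> (forall w, 0 <= eta' w) ->
  (\int[P]_w (eta w)%:E < +oo)%E ->
  (forall C, G C -> \int[P]_(w in U @^-1` C) (eta w)%:E =
                    \int[P]_(w in U' @^-1` C) (eta' w)%:E)%E ->
  forall phi : S -> R, measurable_fun setT phi -> (forall z, 0 <= phi z) ->
  (\int[P]_w (eta w * phi (U w))%:E = \int[P]_w (eta' w * phi (U' w))%:E)%E.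
Proof.
move=> mG GI GT mU mU' meta meta' eta0 eta'0 fin_eta eqG phi mphi phi0.
have eqm C : measurable C ->
    (\int[P]_(w in U @^-1` C) (eta w)%:E =
     \int[P]_(w in U' @^-1` C) (eta' w)%:E)%E.
  have [m1 m1E] := weighted_pushforward_measure P U eta mU meta eta0.
  have [m2 m2E] := weighted_pushforward_measure P U' eta' mU' meta' eta'0.
  rewrite -m1E -m2E.
  apply: (measure_unique G (fun=> setT) mG GI (fun=> GT)).
  - by rewrite -subTset => z _; exists 0%N.
  - by move=> A GA; rewrite m1E m2E; exact: eqG.
  - by move=> _; rewrite m1E preimage_setT.
rewrite layer_cake//; last exact: measurableT_comp.
rewrite layer_cake//; last exact: measurableT_comp.
apply: eq_integral => t _; case: ifP => // _.
have := eqm [set z | t < phi z]; apply.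
rewrite -[X in measurable X]setTI.
exact: (@measurable_fun_ltr _ _ _ _ (cst t) phi).
Qed.

(** * Laws of i.i.d. sequences *)

Section sequence_space.
Context {dV} (V : measurableType dV).

Definition cylinder (n : nat) (B : nat -> set V) : set (nat -> V) :=
  [set D | forall i, (i < n)%N -> B i (D i)].

Definition cylinders : set (set (nat -> V)) :=
  [set C | exists n B, (forall i, measurable (B i)) /\ C = cylinder n B].

Lemma cylinders_setI_closed : setI_closed cylinders.
Proof.
move=> _ _ [n [B [mB ->]]] [m [C [mC ->]]].
exists (maxn n m), (fun i => (if (i < n)%N then B i else setT) `&`
                             (if (i < m)%N then C i else setT)); split.
  by move=> i; apply: measurableI; case: ifP.
apply/seteqP; split => [D [DB DC] i _ /=|D DBC].
  by split; case: ifP => // ?; [exact: DB|exact: DC].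
by split => i lei; (case: (DBC i); first by rewrite leq_max lei ?orbT);
  rewrite /= lei.
Qed.

Lemma cylinders_setT : cylinders setT.
Proof. by exists 0%N, (fun=> setT); split => //; apply/seteqP; split. Qed.

(** The countable product sigma-algebra. Kernels take infinite sequences but read finitely many
    terms, so one space serves all sample sizes and all reindexings. *)
Definition seqspace := g_sigma_algebraType cylinders.

HB.instance Definition _ := Measurable.on seqspace.

Lemma measurable_coordinate (i : nat) :
  measurable_fun setT (fun D : seqspace => D i).
Proof.
move=> _ B mB; rewrite setTI; apply: sub_sigma_algebra.
exists i.+1, (fun j => if j == i then B else setT); split.
  by move=> j; case: ifP.
apply/seteqP; split => D /= => [DB j _|/(_ i (ltnSn i))].
  by case: eqP => [->|].
by rewrite eqxx.
Qed.

Lemma measurable_seqspaceP {d} {T : measurableType d} (U : T -> seqspace) :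
  (forall i, measurable_fun setT (fun w => U w i)) -> measurable_fun setT U.
Proof.
move=> mU; refine (@measurability _ _ T seqspace setT U cylinders erefl _).
move=> _ [_ [n [B [mB ->]]] <-]; rewrite setTI.
have -> : U @^-1` cylinder n B =
    \bigcap_(i in `I_n) ((fun w => U w i) @^-1` B i) by [].
apply: bigcap_measurableType => // i _.
by rewrite -[X in measurable X]setTI; exact: mU.
Qed.

Lemma weighted_seq_eq {d} {T : measurableType d} {R : realType}
    (P : probability T R) (U U' : T -> seqspace) (eta eta' : T -> R) :
  measurable_fun setT U -> measurable_fun setT U' ->
  measurable_fun setT eta -> measurable_fun setT eta' ->
  (forall w, 0 <= eta w) -> (forall w, 0 <= eta' w) ->
  (\int[P]_w (eta w)%:E < +oo)%E ->
  (forall n (B : nat -> set V), (forall i, measurable (B i)) ->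
    \int[P]_(w in [set w | forall i, (i < n)%N -> B i (U w i)]) (eta w)%:E =
    \int[P]_(w in [set w | forall i, (i < n)%N -> B i (U' w i)])
      (eta' w)%:E)%E ->
  forall phi : seqspace -> R, measurable_fun setT phi ->
  (forall D, 0 <= phi D) ->
  (\int[P]_w (eta w * phi (U w))%:E = \int[P]_w (eta' w * phi (U' w))%:E)%E.
Proof.
move=> mU mU' meta meta' eta0 eta'0 fin eqC phi mphi phi0.
apply: (@weighted_pushforward_eq d _ T seqspace R P cylinders) => //.
- exact: cylinders_setI_closed.
- exact: cylinders_setT.
- by move=> _ [n [B [mB ->]]]; exact: eqC.
Qed.

End sequence_space.

Section iid_sequence.
Context {d dV} {T : measurableType d} {V : measurableType dV} {R : realType}.
Variables (P : probability T R) (Z : nat -> T -> V).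
Hypothesis iidZ : iid P Z.

Let mZ i : measurable_fun setT (Z i).
Proof. by case: iidZ. Qed.

Let mZpre i (A : set V) : measurable A -> measurable (Z i @^-1` A).
Proof. by move=> mA; rewrite -[X in measurable X]setTI; exact: mZ. Qed.

Lemma iid_cylinder (n : nat) (B : nat -> set V) (p : nat -> nat) :
  injective p -> (forall i, measurable (B i)) ->
  (P [set w | forall i, (i < n)%N -> B i (Z (p i) w)] =
   \prod_(i <- iota 0 n) P (Z 0%N @^-1` B i))%E.
Proof.
case: iidZ => _ indep ident p_inj mB.
(* Independence is stated with events indexed by observations, whereas [B] is indexed by positions;
   a left inverse [q] of [p] relabels it. *)
have [q pK] : exists q, cancel p q.
  exists (fun j => if pselect (exists i, p i = j) is left h
                   then projT1 (cid h) else 0%N) => i.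
  by case: pselect => [h|[]]; [case: cid => /= j /p_inj|exists i].
have := indep [seq p i | i <- iota 0 n] (B \o q).
rewrite map_inj_uniq ?iota_uniq// => /(_ isT (fun i => mB _)).
rewrite big_map => PE.
transitivity (\prod_(i <- iota 0 n) P (Z (p i) @^-1` (B \o q) (p i)))%E.
  rewrite -PE; congr (P _); apply/seteqP; split => w /=.
    move=> h j /mapP[i]; rewrite mem_iota/= add0n => lein -> /=.
    by rewrite pK; exact: h.
  move=> h i lein; have := h (p i); rewrite /= pK; apply.
  by apply/mapP; exists i => //; rewrite mem_iota.
by apply: eq_bigr => i _; rewrite /= pK ident.
Qed.

Lemma measurable_reindex (p : nat -> nat) :
  measurable_fun setT (fun w => (fun i => Z (p i) w) : seqspace V).
Proof. exact: measurable_seqspaceP. Qed.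

Lemma iid_law_ge0 (p : nat -> nat) (phi : seqspace V -> R) :
  injective p -> measurable_fun setT phi -> (forall D, 0 <= phi D) ->
  (\int[P]_w (phi (fun i => Z (p i) w))%:E =
   \int[P]_w (phi (fun i => Z i w))%:E)%E.
Proof.
move=> p_inj mphi phi0.
have mU := @measurable_reindex.
have := @weighted_seq_eq _ V _ _ _ P _ _ _ _ (mU p) (mU id)
  (measurable_cst (1:R)) (measurable_cst (1:R)) (fun=> ler01) (fun=> ler01).
move=> /(_ _ _ phi mphi phi0) H.
under eq_integral do rewrite -[phi _]mul1r.
under [RHS]eq_integral do rewrite -[phi _]mul1r.
apply: H => [|n B mB].
  by rewrite /= integral_cst//= mul1e probability_setT ltry.
have mC q : measurable [set w | forall i, (i < n)%N -> B i (Z (q i) w)].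
  have -> : [set w | forall i, (i < n)%N -> B i (Z (q i) w)] =
    \bigcap_(i in `I_n) (Z (q i) @^-1` B i) by [].
  by apply: bigcap_measurableType => // i _; exact: mZpre.
rewrite /= !integral_cst//=; congr (_ * _)%E.
by rewrite iid_cylinder// (@iid_cylinder n B id).
Qed.

Lemma iid_law_dep_ge0 (n : nat) (p : nat -> nat) (phi : seqspace V -> R) :
  {in iota 0 n &, injective p} ->
  (forall D D', (forall i, (i < n)%N -> D i = D' i) -> phi D = phi D') ->
  measurable_fun setT phi -> (forall D, 0 <= phi D) ->
  (\int[P]_w (phi (fun i => Z (p i) w))%:E =
   \int[P]_w (phi (fun i => Z i w))%:E)%E.
Proof.
move=> p_inj dep mphi phi0.
(* An injective extension of [p]: beyond [n], the indices exceed the sum of all the values [p j]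
   with [j < n], hence each of them. *)
pose q i := if (i < n)%N then p i else (\sum_(j <- iota 0 n) p j + i).+1.
have lepq i j : (i < n)%N -> (p i < (\sum_(j <- iota 0 n) p j + j).+1)%N.
  move=> lein; rewrite ltnS (leq_trans _ (leq_addr _ _))//.
  by rewrite (big_rem i) ?mem_iota//= leq_addr.
have q_inj : injective q.
  move=> i j; rewrite /q; case: ltnP => lein; case: ltnP => lejn.
  - by apply: p_inj; rewrite mem_iota.
  - by move=> h; have := lepq i j lein; rewrite h ltnn.
  - by move=> h; have := lepq j i lejn; rewrite h ltnn.
  - by move=> [] /addnI.
rewrite -(@iid_law_ge0 q)//; apply: eq_integral => w _.
by congr (_%:E); apply: dep => i lein; rewrite /q lein.
Qed.

Lemma iid_law (n : nat) (p : nat -> nat) (phi : seqspace V -> R) :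
  {in iota 0 n &, injective p} ->
  (forall D D', (forall i, (i < n)%N -> D i = D' i) -> phi D = phi D') ->
  measurable_fun setT phi ->
  (\int[P]_w (phi (fun i => Z (p i) w))%:E =
   \int[P]_w (phi (fun i => Z i w))%:E)%E.
Proof.
move=> p_inj dep mphi; rewrite integralE [RHS]integralE; congr (_ - _)%E.
- under eq_integral do rewrite funeposE -EFin_max.
  under [RHS]eq_integral do rewrite funeposE -EFin_max.
  apply: (@iid_law_dep_ge0 n p (fun D => Num.max (phi D) 0)) => //.
  + by move=> D D' h; rewrite (dep _ _ h).
  + exact: measurable_maxr.
  + by move=> D; rewrite le_max lexx orbT.
- under eq_integral do rewrite funenegE -EFinN -EFin_max.
  under [RHS]eq_integral do rewrite funenegE -EFinN -EFin_max.
  apply: (@iid_law_dep_ge0 n p (fun D => Num.max (- phi D) 0)) => //.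
  + by move=> D D' h; rewrite (dep _ _ h).
  + by apply: measurable_maxr => //; exact: measurable_funN.
  + by move=> D; rewrite le_max lexx orbT.
Qed.

Lemma iid_law_integrable (n : nat) (p : nat -> nat) (phi : seqspace V -> R) :
  {in iota 0 n &, injective p} ->
  (forall D D', (forall i, (i < n)%N -> D i = D' i) -> phi D = phi D') ->
  measurable_fun setT phi ->
  P.-integrable setT (fun w => (phi (fun i => Z i w))%:E) ->
  P.-integrable setT (fun w => (phi (fun i => Z (p i) w))%:E).
Proof.
move=> p_inj dep mphi /integrableP[_ intphi]; apply/integrableP; split.
  exact/measurable_EFinP/(measurableT_comp mphi (measurable_reindex p)).
have := @iid_law_dep_ge0 n p (fun D => `|phi D|) p_inj; rewrite /= => -> //.
- by move=> D D' h; rewrite (dep _ _ h).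
- exact: measurableT_comp.
Qed.

(** The weight [\1_D] and the constant weight P(D) push forward along [Z i] and [Z 0] to the same
    measure: on sets, this is independence together with identity of laws. *)
Lemma indep_weight (i : nat) (D : set T) (g : V -> R) :
  measurable D ->
  (forall A : set V, measurable A ->
    P (D `&` Z i @^-1` A) = (P D * P (Z i @^-1` A))%E) ->
  measurable_fun setT g -> (forall z, 0 <= g z) ->
  (\int[P]_(w in D) (g (Z i w))%:E = P D * \int[P]_w (g (Z 0%N w))%:E)%E.
Proof.
move=> mD indepD mg g0.
have PDfin : P D \is a fin_num by exact: fin_num_measure.
transitivity (\int[P]_w (\1_D w * g (Z i w))%:E)%E.
  rewrite integral_mkcond; apply: eq_integral => w _.
  by rewrite patchE indicE; case: ifP => _; rewrite ?mul1r ?mul0r.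
rewrite (@weighted_pushforward_eq _ _ _ _ _ P measurable (Z i) (Z 0%N)
  (\1_D) (cst (fine (P D)))) //=.
- under eq_integral do rewrite EFinM.
  rewrite ge0_integralZl_EFin//=.
  + by rewrite fineK.
  + by move=> w _; rewrite lee_fin.
  + by apply/measurable_EFinP; exact: measurableT_comp.
  + by rewrite fine_ge0.
- by rewrite sigma_algebra_id//; exact: sigma_algebra_measurable.
- exact: measurableI.
- by move=> w; rewrite fine_ge0.
- rewrite integral_indic//= setIT; apply: le_lt_trans (ltry 1).
  exact: probability_le1.
- move=> A mA; rewrite integral_indic//; last exact: mZpre.
  rewrite integral_cst ?fineK//; last exact: mZpre.
  by apply: (etrans (indepD _ mA)); congr (_ * _)%E; case: iidZ => _ _; exact.
Qed.

(* Plays the role of conditioning on [q (Z i)]: later [q] forgets the label and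
   keeps the covariate. *)
Lemma weight_exchange (i : nat) (q : V -> V) (e1 e2 : V -> R)
    (phi : seqspace V -> R) :
  measurable_fun setT q ->
  measurable_fun setT e1 -> measurable_fun setT e2 ->
  (forall z, 0 <= e1 z) -> (forall z, 0 <= e2 z) ->
  (\int[P]_w (e1 (Z 0%N w))%:E < +oo)%E ->
  (forall A : set V, measurable A ->
    \int[P]_w (e1 (Z 0%N w) * \1_A (q (Z 0%N w)))%:E =
    \int[P]_w (e2 (Z 0%N w) * \1_A (q (Z 0%N w)))%:E)%E ->
  measurable_fun setT phi -> (forall D, 0 <= phi D) ->
  (\int[P]_w (e1 (Z i w) *
     phi (fun j => if j == i then q (Z i w) else Z j w))%:E =
   \int[P]_w (e2 (Z i w) *
     phi (fun j => if j == i then q (Z i w) else Z j w))%:E)%E.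
Proof.
move=> mq me1 me2 e10 e20 fin_e1 e12 mphi phi0.
have mU : measurable_fun setT
    (fun w => (fun j => if j == i then q (Z i w) else Z j w) : seqspace V).
  apply: measurable_seqspaceP => j; case: (j == i) => //.
  exact: measurableT_comp.
(* On a cylinder the weighted integral factors: the observations other than [i] contribute a
   probability free of [e], and observation [i] an integral over an event of [q (Z i)], where [e1]
   and [e2] agree by hypothesis. *)
have key (e : V -> R) n (B : nat -> set V) : measurable_fun setT e ->
    (forall z, 0 <= e z) -> (forall j, measurable (B j)) ->
    (\int[P]_(w in [set w | forall j, (j < n)%N ->
                     B j (if j == i then q (Z i w) else Z j w)]) (e (Z i w))%:E =
     P [set w | forall j, (j < n)%N && (j != i) -> B j (Z j w)] *
     \int[P]_w (e (Z 0%N w) *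
        \1_(if (i < n)%N then B i else setT) (q (Z 0%N w)))%:E)%E.
  move=> me e0 mB; set D := [set w | forall j, (j < n)%N && (j != i) -> _].
  set Bi := if _ then _ else _.
  have mBi : measurable Bi by rewrite /Bi; case: ifP.
  rewrite -(@indep_weight i D (fun z => e z * \1_Bi (q z))).
  - rewrite integral_mkcond [RHS]integral_mkcond.
    apply: eq_integral => w _; rewrite !patchE indicE.
    have -> : (w \in [set w | forall j, (j < n)%N ->
                     B j (if j == i then q (Z i w) else Z j w)]) =
              (w \in D) && (q (Z i w) \in Bi).
      apply/idP/andP; rewrite !inE /D /Bi /=.
        move=> h; split.
          by move=> j /andP[jn ji]; have := h j jn; rewrite (negbTE ji).
        by case: ifP => // lein; have := h i lein; rewrite eqxx.
      move=> [hD hB] j lejn; have [ji|ji] := eqVneq j i.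
        by move: hB; rewrite -ji lejn.
      by apply: hD; rewrite lejn.
    by case: (w \in D) => //=; case: (q (Z i w) \in Bi); rewrite ?mulr1 ?mulr0.
  - have -> : D = \bigcap_(j in [set j | (j < n)%N && (j != i)]) (Z j @^-1` B j) by [].
    by apply: bigcap_measurableType => j _; exact: mZpre.
  - move=> A mA; case: iidZ => _ indep _.
    pose I := [seq j <- iota 0 n | j != i].
    have uI : uniq I by rewrite filter_uniq ?iota_uniq.
    have iI : i \notin I by rewrite mem_filter eqxx.
    have DE : D = \bigcap_(j in [set j | j \in I]) (Z j @^-1` B j).
      rewrite /D; apply/seteqP; split => w h j /=.
        by rewrite mem_filter mem_iota/= add0n andbC => /h.
      by move=> jn; apply: h; rewrite /= mem_filter mem_iota/= add0n andbC.
    have -> : D `&` Z i @^-1` A = \bigcap_(j in [set j | j \in i :: I])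
        (Z j @^-1` (if j == i then A else B j)).
      rewrite DE; apply/seteqP; split => w.
        move=> [hD hA] j /=; rewrite inE => /predU1P[->|jI]; first by rewrite eqxx.
        by case: eqP => [->//|_]; exact: hD.
      move=> h; split => [j jI|].
        have := h j; rewrite /= inE (jI : j \in I) orbT => /(_ isT).
        by case: eqP => // ji; move: iI; rewrite -ji (jI : j \in I).
      by have := h i; rewrite /= inE eqxx => /(_ isT).
    rewrite indep/= ?iI//; last by move=> j; case: ifP.
    rewrite big_cons eqxx muleC; congr (_ * _)%E.
    rewrite DE indep//; apply: eq_big_seq => j jI.
    by case: eqP => // ji; move: iI; rewrite -ji jI.
  - by apply: measurable_funM => //; apply: measurableT_comp.
  - by move=> z; rewrite mulr_ge0.
apply: (@weighted_seq_eq _ V _ _ _ P _ _ _ _ mU mU) => //.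
- exact: measurableT_comp.
- exact: measurableT_comp.
- rewrite (_ : \int[P]_w (e1 (Z i w))%:E = \int[P]_w (e1 (Z 0%N w))%:E)%E//.
  apply: (@iid_law_dep_ge0 1 (fun=> i) (fun D => e1 (D 0%N))) => //.
  + by move=> j k; rewrite !inE => /eqP -> /eqP ->.
  + by move=> D D' DD'; rewrite DD'.
  + exact: measurableT_comp me1 (@measurable_coordinate _ V 0).
- by move=> n B mB; rewrite !key// e12//; case: ifP.
Qed.

End iid_sequence.

(** * Covariance of copies sharing one observation *)

Section square_integrable.
Context {d} {T : measurableType d} {R : realType}.
Variable P : probability T R.

Definition square_integrable (u : T -> R) :=
  measurable_fun setT u /\ P.-integrable setT (EFin \o (fun w => u w ^+ 2)).

Lemma bounded_integrable (M : R) (u : T -> R) :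
  measurable_fun setT u -> (forall w, `|u w| <= M) ->
  P.-integrable setT (EFin \o u).
Proof.
move=> mu uM; apply: (le_integrable measurableT (g := cst M%:E)).
- exact/measurable_EFinP.
- by move=> w _; rewrite /= lee_fin (le_trans (uM w))// ler_norm.
- exact: finite_measure_integrable_cst.
Qed.

Lemma square_integrable_cst (c : R) : square_integrable (cst c).
Proof.
split; first exact: measurable_cst.
apply: (bounded_integrable (c ^+ 2)) => [|w].
  exact: (measurable_cst (c ^+ 2)).
by rewrite /= ger0_norm// sqr_ge0.
Qed.

Lemma square_integrable_mul (u v : T -> R) :
  square_integrable u -> square_integrable v ->
  P.-integrable setT (EFin \o (fun w => u w * v w)).
Proof.
move=> [mu iu] [mv iv].
have := integrableD measurableT iu iv.
apply: le_integrable => //.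
  by apply/measurable_EFinP; exact: measurable_funM.
move=> w _; rewrite /= lee_fin.
rewrite [leRHS]ger0_norm ?addr_ge0 ?sqr_ge0//.
rewrite ler_norml; apply/andP; split.
  by have := sqr_ge0 (u w + v w); have := sqr_ge0 (u w); have := sqr_ge0 (v w); nra.
by have := sqr_ge0 (u w - v w); have := sqr_ge0 (u w); have := sqr_ge0 (v w); nra.
Qed.

Lemma square_integrable_integrable (u : T -> R) :
  square_integrable u -> P.-integrable setT (EFin \o u).
Proof.
move=> /square_integrable_mul /(_ (square_integrable_cst 1)).
by apply: eq_integrable => // w _ /=; rewrite mulr1.
Qed.

Lemma square_integrableD (u v : T -> R) :
  square_integrable u -> square_integrable v ->
  square_integrable (fun w => u w + v w).
Proof.
move=> Lu Lv; have [[mu iu] [mv iv]] := (Lu, Lv); split.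
  exact: measurable_funD.
have iuv := square_integrable_mul _ _ Lu Lv.
have := integrableD measurableT (integrableD measurableT iu iv)
  (integrableD measurableT iuv iuv).
by apply: eq_integrable => // w _ /=; rewrite -!EFinD; congr _%:E; ring.
Qed.

Lemma square_integrable_bounded_mul (M : R) (b u : T -> R) :
  measurable_fun setT b -> (forall w, `|b w| <= M) -> square_integrable u ->
  square_integrable (fun w => b w * u w).
Proof.
move=> mb bM [mu iu]; split; first exact: measurable_funM.
have := integrableZl measurableT (M ^+ 2) iu.
apply: le_integrable => //.
  by apply/measurable_EFinP; apply: measurable_funX; exact: measurable_funM.
move=> w _; rewrite /= lee_fin exprMn !normrM ler_wpM2r//.
by apply: ler_pM => //; rewrite (le_trans (bM w))// ler_norm.
Qed.

Lemma square_integrable_sum (I : Type) (r : seq I) (F : I -> T -> R) :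
  (forall i, square_integrable (F i)) ->
  square_integrable (fun w => \sum_(i <- r) F i w).
Proof.
move=> LF; elim: r => [|i r IHr].
  by under eq_fun do rewrite big_nil; exact: square_integrable_cst.
by under eq_fun do rewrite big_cons; exact: square_integrableD.
Qed.

Lemma Rintegral_sum (I : Type) (r : seq I) (F : I -> T -> R) :
  (forall i, P.-integrable setT (EFin \o F i)) ->
  P.-integrable setT (EFin \o (fun w => \sum_(i <- r) F i w)) /\
  \int[P]_w (\sum_(i <- r) F i w) = \sum_(i <- r) \int[P]_w F i w.
Proof.
move=> iF; elim: r => [|i r [IHi IHr]].
  split; last by under eq_Rintegral do rewrite big_nil;
    rewrite big_nil Rintegral_cst// mul0r.
  apply: (bounded_integrable 0).
    by under eq_fun do rewrite big_nil; exact: measurable_cst.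
  by move=> w; rewrite big_nil normr0.
split; last first.
  by under eq_Rintegral do rewrite big_cons; rewrite RintegralD// IHr big_cons.
have := integrableD measurableT (iF i) IHi.
by apply: eq_integrable => // w _; rewrite /= big_cons EFinD.
Qed.

End square_integrable.

Section exchangeable_copies.
Context {d dV} {T : measurableType d} {V : measurableType dV} {R : realType}.
Variables (P : probability T R) (Z : nat -> T -> V).
Hypothesis iidZ : iid P Z.

(* Indices of the [b]-th resample that shares observation 0 only. *)
Definition block (m b i : nat) : nat := (if i == 0 then 0 else b * m.-1 + i)%N.

Lemma block0 m i : block m 0 i = i.
Proof. by rewrite /block mul0n add0n; case: eqP. Qed.

Lemma blockS m b i : block m b i.+1 = (b * m.-1 + i).+1.
Proof. by rewrite /block /= addnS. Qed.

Lemma block_inj m b : injective (block m b).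
Proof. by case=> [|i] [|j]; rewrite ?blockS// => -[] /addnI ->. Qed.

Lemma block_disjoint m a b i j : a != b -> (0 < i < m)%N -> (0 < j < m)%N ->
  block m a i <> block m b j.
Proof.
case: i => [|i]; first by move=> _ /andP[].
case: j => [|j]; first by move=> _ _ /andP[].
rewrite !blockS => ab im jm -[].
have [ltab|ltba|eqab] := ltngtP a b; last by rewrite eqab eqxx in ab.
- have : (a.+1 * m.-1 <= b * m.-1)%N by rewrite leq_mul2r ltab orbT.
  rewrite mulSn; lia.
- have : (b.+1 * m.-1 <= a * m.-1)%N by rewrite leq_mul2r ltba orbT.
  rewrite mulSn; lia.
Qed.

(** Two distinct copies involve [m + m.-1] distinct observations. [p] lists copy [a] and then copy
    [b] from its position 1 on, the shared observation being already listed. *)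
Lemma block1_inj_on m (p : nat -> nat) a b : a != b ->
  (forall i, p i = if (i < m)%N then block m a i else block m b (i - m.-1)) ->
  {in iota 0 (m + m.-1) &, injective p}.
Proof.
move=> ab pE i j; rewrite !mem_iota !add0n /= => im jm; rewrite !pE.
have [lim|lemi] := ltnP i m; have [ljm|lemj] := ltnP j m.
- exact: block_inj.
- case: i im lim => [|i] im lim h; exfalso.
    have jE : (j - m.-1)%N = (j - m.-1).-1.+1 by lia.
    by move: h; rewrite jE blockS.
  by apply: (@block_disjoint m a b i.+1 (j - m.-1) ab _ _ h); lia.
- case: j jm ljm => [|j] jm ljm h; exfalso.
    have iE : (i - m.-1)%N = (i - m.-1).-1.+1 by lia.
    by move: h; rewrite iE blockS.
  by apply: (@block_disjoint m a b j.+1 (i - m.-1) ab _ _ (esym h)); lia.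
- by move=> /block_inj; lia.
Qed.

Variables (m : nat) (H : seqspace V -> R).
Hypotheses (m_gt0 : (0 < m)%N) (mH : measurable_fun setT H).
Hypothesis depH : forall D D', (forall i, (i < m)%N -> D i = D' i) -> H D = H D'.

Let u b w := H (fun i => Z (block m b i) w).

Let mreindex (p : nat -> nat) :
  measurable_fun setT (fun D : seqspace V => (fun i => D (p i)) : seqspace V).
Proof. by apply: measurable_seqspaceP => i; exact: measurable_coordinate. Qed.

Lemma square_integrable_copy b : square_integrable P (u 0%N) ->
  square_integrable P (u b) /\ \int[P]_w (u b w ^+ 2) = \int[P]_w (u 0%N w ^+ 2).
Proof.
have u0E : u 0%N = fun w => H (fun i => Z i w).
  by apply/funext => w; rewrite /u; congr H; apply/funext => i; rewrite block0.
have mH2 : measurable_fun setT (fun D => H D ^+ 2) by exact: measurable_funX.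
have dep2 D D' : (forall i, (i < m)%N -> D i = D' i) -> H D ^+ 2 = H D' ^+ 2.
  by move=> h; rewrite (depH _ _ h).
have binj : {in iota 0 m &, injective (block m b)} by move=> i j _ _ /block_inj.
rewrite u0E => -[_ i0]; split; last first.
  by congr fine; exact: (iid_law _ _ iidZ m (block m b) (fun D => H D ^+ 2)).
split; first exact: measurableT_comp mH (measurable_reindex _ _ iidZ (block m b)).
exact: (iid_law_integrable _ _ iidZ m (block m b) (fun D => H D ^+ 2)).
Qed.

Lemma Rintegral_copies a b : a != b ->
  \int[P]_w (u a w * u b w) = \int[P]_w (u 0%N w * u 1%N w).
Proof.
move=> ab.
pose p i := if (i < m)%N then block m a i else block m b (i - m.-1).
(* [phi] reads copies 0 and 1 off the first [m + m.-1] positions, and [p] sends these positions to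
   the observations of copies [a] and [b]. Any two distinct copies thus have the joint law of the
   first two. *)
pose phi (D : seqspace V) := H D * H (fun i => D (block m 1 i)).
have E0 w : u 0%N w * u 1%N w = phi (fun i => Z i w).
  by rewrite /u /phi; congr (H _ * _); apply/funext => i; rewrite block0.
have Eab w : u a w * u b w = phi (fun i => Z (p i) w).
  rewrite /u /phi; congr (_ * _); apply: depH => i lim; rewrite /p ?lim//.
  case: i lim => [|i] lim; first by rewrite m_gt0.
  rewrite (blockS m 1) mul1n ifF; last lia.
  by congr (Z (block _ _ _) w); lia.
under eq_Rintegral do rewrite Eab.
under [RHS]eq_Rintegral do rewrite E0.
congr fine; apply: (iid_law _ _ iidZ (m + m.-1) p phi).
- exact: (block1_inj_on m p a b).
- move=> D D' h; rewrite /phi; congr (_ * _); apply: depH => i lim; apply: h.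
    lia.
  case: i lim => [|i] lim; first exact: ltn_addr.
  by rewrite blockS; lia.
- exact: measurable_funM mH (measurableT_comp mH (mreindex (block m 1))).
Qed.

(* The second moment of a sum of [N] copies is [N E u0^2 + N (N - 1) E[u0 u1]],
   and it is nonnegative for every [N]. *)
Lemma copies_covariance_ge0 :
  square_integrable P (u 0%N) -> 0 <= \int[P]_w (u 0%N w * u 1%N w).
Proof.
move=> L0; have Lu b := (square_integrable_copy b L0).1.
set C := (X in 0 <= X); set B := \int[P]_w (u 0%N w ^+ 2).
have key N : 0 <= N%:R * B + (N%:R * (N%:R - 1)) * C.
  have iuu a b : P.-integrable setT (EFin \o (fun w => u a w * u b w)).
    exact: square_integrable_mul.
  have -> : N%:R * B + N%:R * (N%:R - 1) * C =
      \sum_(a < N) \sum_(b < N) \int[P]_w (u a w * u b w).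
    transitivity (\sum_(a < N) (B + (N%:R - 1) * C)).
      by rewrite sumr_const card_ord -mulr_natl; ring.
    apply: eq_bigr => a _; rewrite (bigD1 a)//=; congr (_ + _).
      rewrite /B -(square_integrable_copy a L0).2.
      by apply: eq_Rintegral => w _; rewrite expr2.
    rewrite (eq_bigr (fun=> C)); last first.
      by move=> b ba; apply: Rintegral_copies; rewrite eq_sym.
    rewrite sumr_const; have := cardC1 a; rewrite card_ord => cE.
    rewrite -[RHS]mulr_natl; congr (_ * _).
    rewrite (eq_card (B := predC1 a)) ?cE//.
    by case: N a {cE} => [[]//|N a]; rewrite /= -natr1 addrK.
  have [_ E2] := Rintegral_sum P 'I_N (index_enum 'I_N)
    (fun a w => \sum_(b < N) (u a w * u b w))
    (fun a => (Rintegral_sum P 'I_N (index_enum 'I_N) _ (fun b => iuu a b)).1).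
  under eq_bigr do rewrite -(Rintegral_sum P 'I_N (index_enum 'I_N) _ (iuu _)).2.
  rewrite -E2; apply: Rintegral_ge0 => w _.
  under eq_bigr do rewrite -mulr_sumr.
  by rewrite -mulr_suml -expr2 sqr_ge0.
rewrite leNgt; apply/negP => C_lt0.
have B0 : 0 <= B by apply: Rintegral_ge0 => w _; exact: sqr_ge0.
(* Large enough for [(N - 1) * - C] to exceed [B], which contradicts [key N] divided by [N]. *)
pose N := (Num.truncn (B / - C)).+2.
have : B / - C < N%:R - 1.
  rewrite /N -natr1 addrK; apply: truncnS_gt.
rewrite ltr_pdivrMr ?oppr_gt0// => BN.
have := key N; rewrite -mulrA -mulrDr pmulr_rge0; last by rewrite ltr0n.
by move: BN; lra.
Qed.

End exchangeable_copies.

(** * Nearest neighbours without ties *)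

Lemma measurable_boolR {d} {T : measurableType d} {R : realType}
    (b : T -> bool) :
  measurable_fun setT b -> measurable_fun setT (fun w => (b w)%:R : R).
Proof.
move=> mb; rewrite (_ : (fun w => _) = fun w => if b w then 1 else 0 : R).
  exact: measurable_fun_ifT.
by apply/funext => w; case: (b w).
Qed.

(** The joint law is the product of the marginals, and every section of the diagonal is a single
    point, which [Y] charges with probability 0. *)
Lemma independent_no_tie {d} {T : measurableType d} {R : realType}
    (P : probability T R) (X Y : T -> R) :
  measurable_fun setT X -> measurable_fun setT Y ->
  (forall A B : set R, measurable A -> measurable B ->
     P (X @^-1` A `&` Y @^-1` B) = (P (X @^-1` A) * P (Y @^-1` B))%E) ->
  (forall r, P (Y @^-1` [set r]) = 0%E) ->
  P [set w | X w = Y w] = 0%E.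
Proof.
move=> mX mY indep noatom.
pose X' : {RV P >-> R} := mfun_Sub (mem_set mX).
pose Y' : {RV P >-> R} := mfun_Sub (mem_set mY).
have mXY : measurable_fun setT (fun w => (X w, Y w)).
  exact: measurable_fun_pair.
pose diag := [set z : R * R | z.1 = z.2].
have mdiag : measurable diag.
  have -> : diag = (fun z : R * R => z.1 == z.2) @^-1` [set true].
    by apply/seteqP; split => z /=; [move=> ->; rewrite eqxx|move/eqP].
  rewrite -[X in measurable X]setTI.
  by apply: measurable_fun_eqr.
pose m' := pushforward P (fun w => (X w, Y w)).
have [m'' m''E] : exists m : {measure set (R * R) -> \bar R},
    forall A, m A = m' A.
  by unshelve eexists (pushforward P (fun w => (X w, Y w)) :
    {measure set (R * R) -> \bar R}).
have h := @product_measure_unique _ _ _ _ _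
  (distribution P X') (distribution P Y') m''.
have -> : P [set w | X w = Y w] = m'' diag by rewrite m''E.
rewrite -h//; last by move=> A B mA mB; rewrite m''E; exact: indep.
rewrite /product_measure1 integral0_eq// => r _ /=.
have -> : xsection diag r = [set r].
  apply/seteqP; split => s; rewrite /xsection/= inE /diag/=; first by move=> ->.
  by move=> ->.
exact: noatom.
Qed.

(** The test of [nn_sub] on a list of indices rather than a finite set: reindexing the sample
    becomes a [map], and joining two samples a concatenation. *)
Definition nearest {R : realType} {V : Type} (score : V -> R) (s : seq nat)
    (i : nat) (D : nat -> V) : bool :=
  all (fun j => (j != i) ==> (score (D i) < score (D j))) s.

Section nearest.
Context {R : realType} {V : Type} (score : V -> R).
Notation nearest := (nearest score).

Lemma nearest_uniq s i k D :
  i \in s -> k \in s -> nearest s i D -> nearest s k D -> i = k.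
Proof.
move=> si sk /allP/(_ k sk) ik /allP/(_ i si) ki; apply/eqP/contraT => neq.
move: ik ki; rewrite eq_sym neq /= => ik ki.
by have := lt_trans ik ki; rewrite ltxx.
Qed.

Lemma sum_nearest_le1 s D : uniq s ->
  \sum_(i <- s) (nearest s i D)%:R <= 1 :> R.
Proof.
move=> us; case: (boolP (has (fun i => nearest s i D) s)) => [/hasP[k sk nk]|no].
  rewrite (big_rem k)//= nk big_seq big1 ?addr0// => i.
  rewrite (mem_rem_uniq _ us) inE => /andP[ik si].
  case: (boolP (nearest s i D)) => // ni.
  by rewrite (@nearest_uniq s i k D si sk ni nk) eqxx in ik.
rewrite big_seq big1 ?ler01// => i si.
by have /hasPn/(_ i si)/negbTE -> := no.
Qed.

(** At most one of the weights is nonzero and it equals 1, so both sides reduce to a single term, or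
    to 0 when the minimum is tied. *)
Lemma sum_nearest_sqr s D (y : nat -> R) : uniq s ->
  (\sum_(i <- s) (nearest s i D)%:R * y i) ^+ 2 =
  \sum_(i <- s) (nearest s i D)%:R * y i ^+ 2.
Proof.
move=> us; case: (boolP (has (fun i => nearest s i D) s)) => [/hasP[k sk nk]|no].
  have only (z : nat -> R) : \sum_(i <- s) (nearest s i D)%:R * z i = z k.
    rewrite (big_rem k)//= nk mul1r big_seq big1 ?addr0// => i.
    rewrite (mem_rem_uniq _ us) inE => /andP[ik si].
    case: (boolP (nearest s i D)) => [ni|]; last by rewrite mul0r.
    by rewrite (@nearest_uniq s i k D si sk ni nk) eqxx in ik.
  by rewrite !only.
have zero (z : nat -> R) : \sum_(i <- s) (nearest s i D)%:R * z i = 0.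
  rewrite big_seq big1// => i si.
  by have /hasPn/(_ i si)/negbTE -> := no; rewrite mul0r.
by rewrite !zero expr0n.
Qed.

(** A minimiser of the score is either strictly nearest or tied with another index. After
    integration the ties vanish, which shows that some index is nearest almost surely. *)
Lemma nearest_or_tie s D : s != [::] ->
  1 <= \sum_(i <- s) (nearest s i D)%:R +
       \sum_(i <- s) \sum_(j <- s)
         ((i != j) && (score (D i) == score (D j)))%:R :> R.
Proof.
move=> s0.
have [i si imin] : exists2 i, i \in s & forall j, j \in s -> score (D i) <= score (D j).
  elim: s s0 => // i [|k s] IH _.
    by exists i => [|j]; rewrite ?mem_head// inE => /eqP ->.
  have [//|l sl lmin] := IH.
  have [il|li] := leP (score (D i)) (score (D l)).
    exists i; rewrite ?mem_head// => j; rewrite inE => /predU1P[->//|sj].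
    by rewrite (le_trans il)// lmin.
  exists l; first by rewrite inE sl orbT.
  by move=> j; rewrite inE => /predU1P[->|/lmin//]; exact: ltW.
have le1 (F : nat -> R) (r : seq nat) k : (forall j, 0 <= F j) -> k \in r ->
    F k <= \sum_(j <- r) F j.
  by move=> F0 kr; rewrite (big_rem k)//= lerDl sumr_ge0.
case: (boolP (nearest s i D)) => [ni|/allPn[j sj]].
  rewrite -[leLHS]addr0; apply: lerD; last first.
    by apply: sumr_ge0 => k _; exact: sumr_ge0.
  by apply: le_trans (le1 _ s i _ si) => //=; rewrite ni.
rewrite negb_imply => /andP[ji]; rewrite -leNgt => jlei.
rewrite -[leLHS]add0r; apply: lerD; first exact: sumr_ge0.
apply: le_trans (le1 _ s i _ si) => [|k]; last exact: sumr_ge0.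
apply: le_trans (le1 _ s j _ sj) => //.
by rewrite eq_sym ji (_ : _ == _)// eq_le imin.
Qed.

Lemma nearest_reindex (p : nat -> nat) s i (D : nat -> V) :
  i \in s -> {in s &, injective p} ->
  nearest s i (fun j => D (p j)) = nearest (map p s) (p i) D.
Proof.
move=> si p_inj; rewrite /nearest all_map; apply: eq_in_all => j sj /=.
by rewrite (inj_in_eq p_inj).
Qed.

End nearest.

Section nearest_probability.
Context {d dV} {T : measurableType d} {V : measurableType dV} {R : realType}.
Variables (P : probability T R) (Z : nat -> T -> V) (score : V -> R).
Hypothesis iidZ : iid P Z.
Hypothesis mscore : measurable_fun setT score.
Hypothesis score_no_atom : forall r, P ((score \o Z 0%N) @^-1` [set r]) = 0%E.

Lemma measurable_nearest s i :
  measurable_fun setT (fun D : seqspace V => nearest score s i D).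
Proof.
elim: s => [|j s IHs]; first exact: measurable_cst.
apply: measurable_and => //; case: (j != i) => /=; last exact: measurable_cst.
by apply: measurable_fun_ltr;
  apply: measurableT_comp => //; exact: measurable_coordinate.
Qed.

Lemma measurable_nearest_sample s i :
  measurable_fun setT (fun w => nearest score s i (fun j => Z j w)).
Proof.
exact: measurableT_comp (measurable_nearest s i) (measurable_reindex _ _ iidZ id).
Qed.

Lemma nearest_integrable s i :
  P.-integrable setT (EFin \o (fun w =>
    (nearest score s i (fun j => Z j w))%:R)).
Proof.
apply: (bounded_integrable P 1).
  by apply: measurable_boolR; exact: measurable_nearest_sample.
by move=> w; rewrite ger0_norm//; case: (nearest _ _ _ _).
Qed.

Lemma score_tie i j : i != j ->
  P [set w | score (Z i w) = score (Z j w)] = 0%E.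
Proof.
move=> ij; case: (iidZ) => mZ indep ident.
have mpre A : measurable A -> measurable (score @^-1` A).
  by move=> mA; rewrite -[X in measurable X]setTI; exact: mscore.
apply: (independent_no_tie P (score \o Z i) (score \o Z j)).
- exact: measurableT_comp.
- exact: measurableT_comp.
- move=> A B mA mB.
  have := indep [:: i; j] (fun k => if k == i then score @^-1` A else score @^-1` B).
  rewrite /= inE ij => /(_ isT) /(_ _).
  rewrite !big_cons big_nil mule1 eqxx eq_sym (negbTE ij) => <-; last first.
    by move=> k; case: ifP => _; exact: mpre.
  congr (P _); apply/seteqP; split => w /=.
    move=> [wA wB] k /=; rewrite !inE => /orP[]/eqP ->; first by rewrite eqxx.
    by rewrite eq_sym (negbTE ij).
  move=> h; have := h i; have := h j.
  by rewrite /= !inE !eqxx eq_sym (negbTE ij) orbT => /(_ isT) ? /(_ isT) ?.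
- move=> r; rewrite -[RHS](score_no_atom r).
  exact: ident (mpre _ (measurable_set1 r)).
Qed.

(** Transposing two indices of [s] preserves the law of the sample, so all indices of [s] are
    nearest with the same probability. These probabilities sum to 1: at most 1 because the nearest
    index is unique, at least 1 because ties are null. *)
Lemma nearest_probability s i : uniq s -> i \in s ->
  \int[P]_w (nearest score s i (fun j => Z j w))%:R = (size s)%:R^-1 :> R.
Proof.
move=> us si.
have s_neq0 : s != [::] by apply: contraTneq si => ->.
have eqp k : k \in s ->
    \int[P]_w (nearest score s k (fun j => Z j w))%:R =
    \int[P]_w (nearest score s i (fun j => Z j w))%:R :> R.
  move=> sk.
  pose p j := if j == i then k else if j == k then i else j.
  have pK : involutive p.
    move=> j; rewrite /p; case: (eqVneq j i) => [->|ji].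
      by case: (eqVneq k i) => [->//|]; rewrite eqxx.
    case: (eqVneq j k) => [->|jk]; first by rewrite eqxx.
    by rewrite (negbTE ji) (negbTE jk).
  have p_inj := inv_inj pK.
  have ps j : j \in s -> p j \in s by rewrite /p; case: eqP => // _; case: eqP.
  have perm : perm_eq (map p s) s.
    apply: uniq_perm => //; first by rewrite map_inj_uniq.
    move=> j; apply/mapP/idP => [[l sl ->]|sj]; first exact: ps.
    by exists (p j); rewrite ?pK//; exact: ps.
  rewrite /Rintegral -(iid_law_ge0 P Z iidZ p
    (fun D => (nearest score s i D)%:R)) //; last first.
    by apply: measurable_boolR; exact: measurable_nearest.
  congr fine; apply: eq_integral => w _; congr (_%:R%:E).
  rewrite (nearest_reindex score p s i (fun j => Z j w))//; last by move=> ? ? _ _ /p_inj.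
  rewrite [in RHS]/nearest (perm_all _ perm) /p eqxx.
  by [].
have [iS ES] := Rintegral_sum P _ s _ (nearest_integrable s).
have iT i' j' : P.-integrable setT (EFin \o (fun w =>
    ((i' != j') && (score (Z i' w) == score (Z j' w)))%:R)).
  apply: (bounded_integrable P 1).
    apply: measurable_boolR; case: (i' != j') => /=; last exact: measurable_cst.
    by apply: measurable_fun_eqr; apply: measurableT_comp => //; case: iidZ.
  by move=> w; rewrite ger0_norm//; case: (_ && _).
have iT1 i' := Rintegral_sum P _ s _ (iT i').
have [iT2 ET] := Rintegral_sum P _ s _ (fun i' => (iT1 i').1).
have sum1 : \sum_(k <- s) \int[P]_w (nearest score s k (fun j => Z j w))%:R = 1 :> R.
  have E1 : \int[P]_w 1 = 1 :> R.
    rewrite Rintegral_cst// mul1r -[RHS]/(fine 1%E); congr fine.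
    exact: probability_setT.
  have i1 : P.-integrable setT (EFin \o (fun=> 1 : R)).
    exact: finite_measure_integrable_cst.
  apply/eqP; rewrite -ES eq_le; apply/andP; split.
    rewrite -[leRHS]E1; apply: le_Rintegral => // w _.
    exact: sum_nearest_le1.
  rewrite -[leLHS]E1 -[leRHS]addr0.
  have tie0 : \int[P]_w (\sum_(i' <- s) \sum_(j' <- s)
      ((i' != j') && (score (Z i' w) == score (Z j' w)))%:R) = 0 :> R.
    rewrite ET big1// => i' _; rewrite (iT1 i').2 big1// => j' _.
    case: (eqVneq i' j') => /= [_|neq]; first by rewrite Rintegral_cst// mul0r.
    have mE : measurable [set w | score (Z i' w) = score (Z j' w)].
      have -> : [set w | score (Z i' w) = score (Z j' w)] =
          (fun w => score (Z i' w) == score (Z j' w)) @^-1` [set true].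
        by apply/seteqP; split => w /=; [move=> ->; rewrite eqxx|move/eqP].
      rewrite -[X in measurable X]setTI.
      by apply: measurable_fun_eqr => //; apply: measurableT_comp => //; case: iidZ.
    transitivity (fine (P [set w | score (Z i' w) = score (Z j' w)])); last first.
      by rewrite score_tie.
    rewrite -[P _]mul1e -[in RHS](setIT [set w | _]) -integral_indic//.
    congr fine; rewrite mul1e; apply: eq_integral => w _.
    rewrite indicE; case: (eqVneq (score (Z i' w)) (score (Z j' w))) => e.
      by rewrite mem_set.
    by rewrite memNset//=; exact/eqP.
  rewrite -[X in _ + X]tie0 -RintegralD//; apply: le_Rintegral => //.
    have := integrableD measurableT iS iT2.
    by apply: eq_integrable.
  by move=> w _; exact: nearest_or_tie.
move: sum1; rewrite big_seq (eq_bigr _ eqp) -big_seq big_const_seq count_predT.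
rewrite iter_addr_0 => h.
have s0 : (size s)%:R != 0 :> R by rewrite pnatr_eq0 size_eq0.
by apply: (mulIf s0); rewrite mulr_natr h mulVf.
Qed.

End nearest_probability.

(** * Moments of nearest-neighbour kernels *)

Lemma pos_neg_parts {R : realDomainType} (a : R) :
  a = Num.max a 0 - Num.max (- a) 0.
Proof. by case: (leP a 0); case: (leP (- a) 0); lra. Qed.

Lemma pos_part_mul {R : realDomainType} (a b : R) :
  Num.max (a * b) 0 =
  Num.max a 0 * Num.max b 0 + Num.max (- a) 0 * Num.max (- b) 0.
Proof.
have [a0|a0] := leP a 0; have [b0|b0] := leP b 0.
- rewrite (max_l (_ : 0 <= - a)) ?oppr_ge0// (max_l (_ : 0 <= - b)) ?oppr_ge0//.
  by rewrite max_l; [ring|rewrite -mulrNN mulr_ge0 ?oppr_ge0].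
- rewrite (max_r (_ : - b <= 0)) ?oppr_le0 1?ltW// max_r; first by ring.
  by rewrite mulr_le0_ge0// ltW.
- rewrite (max_r (_ : - a <= 0)) ?oppr_le0 1?ltW// max_r; first by ring.
  by rewrite mulr_ge0_le0// ltW.
- rewrite (max_r (_ : - b <= 0)) ?oppr_le0 1?ltW// max_l; first by ring.
  by rewrite mulr_ge0// ltW.
Qed.

Lemma neg_part_mul {R : realDomainType} (a b : R) :
  Num.max (- (a * b)) 0 =
  Num.max (- a) 0 * Num.max b 0 + Num.max a 0 * Num.max (- b) 0.
Proof. by rewrite -mulNr pos_part_mul opprK. Qed.

Section regression.
Context {d dX} {T : measurableType d} {X : measurableType dX} {R : realType}.
Let V : measurableType _ := (X * R)%type.
Variables (P : probability T R) (Z : nat -> T -> V).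
Variables (score mt sg : X -> R) (M smin smax : R).
Hypothesis iidZ : iid P Z.
Hypothesis mscore : measurable_fun setT score.
Hypothesis mmt : measurable_fun setT mt.
Hypothesis msg : measurable_fun setT sg.
Hypothesis mtM : forall x, `|mt x| <= M.
Hypothesis smin_ge0 : 0 <= smin.
Hypothesis sg_bounds : forall x, smin <= sg x <= smax.

(** [mt] and [sg] are bounded and measurable on the whole space. They are later instantiated by
    extensions of [mu] and [sigma2] from the support of the covariate, so that this is almost surely
    the noise of the model. *)
Definition noise (z : V) : R := z.2 - mt z.1.

Hypothesis noise2_integrable :
  P.-integrable setT (EFin \o (fun w => noise (Z 0%N w) ^+ 2)).
Hypothesis noise_centered : forall A : set X, measurable A ->
  (\int[P]_w (noise (Z 0%N w) * \1_A (Z 0%N w).1)%:E = 0)%E.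
Hypothesis noise_variance : forall A : set X, measurable A ->
  (\int[P]_w (noise (Z 0%N w) ^+ 2 * \1_A (Z 0%N w).1)%:E =
   \int[P]_w (sg (Z 0%N w).1 * \1_A (Z 0%N w).1)%:E)%E.
Hypothesis score_no_atom :
  forall r, P ((fun w => score (Z 0%N w).1) @^-1` [set r]) = 0%E.

Let mZ i : measurable_fun setT (Z i).
Proof. by case: iidZ. Qed.

Let mX i : measurable_fun setT (fun w => (Z i w).1).
Proof. by apply: measurableT_comp. Qed.

Let mnoise : measurable_fun setT noise.
Proof.
apply: measurable_funB; first exact: measurable_snd.
exact: measurableT_comp.
Qed.

Let square_integrable_noise i : square_integrable P (fun w => noise (Z i w)).
Proof.
split; first exact: measurableT_comp.
apply: (iid_law_integrable P Z iidZ 1 (fun=> i) (fun D => noise (D 0%N) ^+ 2)).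
- by move=> j k; rewrite !inE => /eqP -> /eqP ->.
- by move=> D D' DD'; rewrite DD'.
- apply: measurable_funX.
  exact: measurableT_comp mnoise (@measurable_coordinate _ V 0).
- exact: noise2_integrable.
Qed.

Let forget (z : V) : V := (z.1, 0).

Let mforget : measurable_fun setT forget.
Proof. by apply: measurable_fun_pair => //; exact: measurable_fst. Qed.

(** The sample with its i-th label erased. Functions of [masked i] play the part of the variables
    measurable with respect to X_i and the other observations. *)
Let masked i w : seqspace V :=
  fun j => if j == i then forget (Z i w) else Z j w.

Let mmasked i : measurable_fun setT (masked i).
Proof.
apply: measurable_seqspaceP => j; rewrite /masked; case: (j == i) => //.
exact: measurableT_comp.
Qed.

Let forget_indic (A : set V) w : \1_A (forget (Z 0%N w)) =
  \1_[set x | A (x, 0)] (Z 0%N w).1 :> R.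
Proof. by rewrite !indicE; congr (_%:R). Qed.

Let mforget_section (A : set V) : measurable A ->
  measurable [set x : X | A (x, 0 : R)].
Proof.
move=> mA; have mpair : measurable_fun setT (fun x : X => (x, 0 : R) : V).
  exact: measurable_fun_pair.
by have := mpair measurableT A mA; rewrite setTI.
Qed.

(** Centering says that the positive and negative parts of the noise have equal integrals over
    covariate events, so these two weights can be exchanged against any nonnegative function of
    [masked i]. Splitting [phi] by sign as well, the positive and negative parts of the product get
    the same integral. *)
Lemma noise_orthogonal i (phi : seqspace V -> R) :
  measurable_fun setT phi ->
  P.-integrable setT (EFin \o (fun w => noise (Z i w) * phi (masked i w))) ->
  \int[P]_w (noise (Z i w) * phi (masked i w)) = 0.
Proof.
move=> mphi iphi.
pose e1 z := Num.max (noise z) 0; pose e2 z := Num.max (- noise z) 0.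
pose p1 z := Num.max (phi z) 0; pose p2 z := Num.max (- phi z) 0.
have me1 : measurable_fun setT e1 by exact: measurable_maxr.
have me2 : measurable_fun setT e2.
  by apply: measurable_maxr => //; exact: measurable_funN.
have mp1 : measurable_fun setT p1 by exact: measurable_maxr.
have mp2 : measurable_fun setT p2.
  by apply: measurable_maxr => //; exact: measurable_funN.
have e1_ge0 z : 0 <= e1 z by rewrite le_max lexx orbT.
have e2_ge0 z : 0 <= e2 z by rewrite le_max lexx orbT.
have p1_ge0 z : 0 <= p1 z by rewrite le_max lexx orbT.
have p2_ge0 z : 0 <= p2 z by rewrite le_max lexx orbT.
have noiseE z : noise z = e1 z - e2 z by exact: pos_neg_parts.
have intb (e : V -> R) (A : set V) : measurable_fun setT e -> measurable A ->
    (forall z, `|e z| <= `|noise z|) ->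
    P.-integrable setT (EFin \o (fun w => e (Z 0%N w) * \1_A (forget (Z 0%N w)))).
  move=> me mA ebound.
  have := square_integrable_integrable P _ (square_integrable_noise 0).
  apply: le_integrable => //.
    apply/measurable_EFinP; apply: measurable_funM.
      exact: measurableT_comp.
    have m1A : measurable_fun setT (\1_A : V -> R) by exact: measurable_indic.
    exact: measurableT_comp m1A (measurableT_comp mforget (mZ 0%N)).
  move=> w _; rewrite /= lee_fin normrM (le_trans _ (ebound _))//.
  by rewrite ler_piMr// indicE; case: (_ \in _); rewrite ?normr1 ?normr0.
have b1 z : `|e1 z| <= `|noise z|.
  by rewrite ger0_norm// /e1 ge_max ler_norm normr_ge0.
have b2 z : `|e2 z| <= `|noise z|.
  by rewrite ger0_norm// /e2 ge_max -{1}normrN ler_norm normr_ge0.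
have e12 A : measurable A ->
    (\int[P]_w (e1 (Z 0%N w) * \1_A (forget (Z 0%N w)))%:E =
     \int[P]_w (e2 (Z 0%N w) * \1_A (forget (Z 0%N w)))%:E)%E.
  move=> mA.
  have i1 := intb e1 A me1 mA b1; have i2 := intb e2 A me2 mA b2.
  have := noise_centered _ (mforget_section A mA).
  under eq_integral do rewrite -forget_indic noiseE mulrBl EFinB.
  rewrite integralB_EFin// => /eqP.
  rewrite sube_eq ?fin_num_adde_defr ?integrable_fin_num//.
  by rewrite add0e => /eqP.
have fin1 : (\int[P]_w (e1 (Z 0%N w))%:E < +oo)%E.
  have := intb e1 setT me1 measurableT b1.
  move/integrable_fin_num => /(_ measurableT).
  rewrite ge0_fin_numE; last first.
    by apply: integral_ge0 => w _; rewrite lee_fin mulr_ge0.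
  by under eq_integral do rewrite /= indicT mulr1.
have exch := weight_exchange P Z iidZ i forget e1 e2 _
  mforget me1 me2 e1_ge0 e2_ge0 fin1 e12.
have E1 := exch p1 mp1 p1_ge0; have E2 := exch p2 mp2 p2_ge0.
have mm (e : V -> R) (p : seqspace V -> R) : measurable_fun setT e ->
    measurable_fun setT p ->
    measurable_fun setT (fun w => (e (Z i w) * p (masked i w))%:E).
  move=> me mp; apply/measurable_EFinP; apply: measurable_funM.
    exact: measurableT_comp.
  exact: measurableT_comp mp (mmasked i).
rewrite /Rintegral integralE.
have posE : (\int[P]_x (fun w => (noise (Z i w) * phi (masked i w))%:E)^\+ x =
    \int[P]_w (e1 (Z i w) * p1 (masked i w))%:E +
    \int[P]_w (e2 (Z i w) * p2 (masked i w))%:E)%E.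
  rewrite -ge0_integralD//; [|by move=> w _; rewrite lee_fin mulr_ge0|exact: mm|
    by move=> w _; rewrite lee_fin mulr_ge0|exact: mm].
  apply: eq_integral => w _; rewrite funeposE -EFin_max -EFinD; congr _%:E.
  exact: pos_part_mul.
have negE : (\int[P]_x (fun w => (noise (Z i w) * phi (masked i w))%:E)^\- x =
    \int[P]_w (e2 (Z i w) * p1 (masked i w))%:E +
    \int[P]_w (e1 (Z i w) * p2 (masked i w))%:E)%E.
  rewrite -ge0_integralD//; [|by move=> w _; rewrite lee_fin mulr_ge0|exact: mm|
    by move=> w _; rewrite lee_fin mulr_ge0|exact: mm].
  apply: eq_integral => w _; rewrite funenegE -EFinN -EFin_max -EFinD; congr _%:E.
  exact: neg_part_mul.
rewrite [X in (_ - X)%E](_ : _ = \int[P]_x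
  (fun w => (noise (Z i w) * phi (masked i w))%:E)^\+ x)%E.
  rewrite subee//.
  by apply: integrable_fin_num => //; exact: integrable_funepos.
by rewrite posE negE E1 E2.
Qed.

(** The exchange of the weights [noise ^+ 2] and [sg] concerns nonnegative functions. It is applied
    to [phi + K], and the contribution of [K] cancels because both weights have the same total
    integral. *)
Lemma noise_square_bounded i (K : R) (phi : seqspace V -> R) :
  measurable_fun setT phi -> (forall D, `|phi D| <= K) ->
  P.-integrable setT (EFin \o (fun w => noise (Z i w) ^+ 2 * phi (masked i w))) /\
  \int[P]_w (noise (Z i w) ^+ 2 * phi (masked i w)) =
  \int[P]_w (sg (Z i w).1 * phi (masked i w)).
Proof.
move=> mphi phiK.
have K0 : 0 <= K by exact: le_trans (phiK point).
have noise2_ge0 z : 0 <= noise z ^+ 2 by exact: sqr_ge0.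
have sg0 x : 0 <= sg x by case/andP: (sg_bounds x) => + _; exact: le_trans.
have msgZ : measurable_fun setT (fun w => sg (Z i w).1) by exact: measurableT_comp.
have mphim : measurable_fun setT (fun w => phi (masked i w)).
  exact: measurableT_comp mphi (mmasked i).
have sgS x : `|sg x| <= smax by rewrite ger0_norm//; case/andP: (sg_bounds x).
have smax0 : 0 <= smax by exact: le_trans (sgS point).
have i1 : P.-integrable setT
    (EFin \o (fun w => noise (Z i w) ^+ 2 * phi (masked i w))).
  have := integrableZl measurableT K (square_integrable_noise i).2.
  apply: le_integrable => //.
    apply/measurable_EFinP; apply: measurable_funM => //.
    by apply: measurable_funX; exact: measurableT_comp.
  move=> w _; rewrite /= lee_fin mulrC !normrM ler_wpM2r//.
  by rewrite (le_trans (phiK _))// ler_norm.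
have i2 : P.-integrable setT (EFin \o (fun w => sg (Z i w).1 * phi (masked i w))).
  apply: (bounded_integrable P (smax * K)); first exact: measurable_funM.
  by move=> w; rewrite normrM ler_pM.
split => //.
have i3 := (square_integrable_noise i).2.
have i4 : P.-integrable setT (EFin \o (fun w => sg (Z i w).1)).
  exact: (bounded_integrable P smax).
have key (psi : seqspace V -> R) : measurable_fun setT psi ->
    (forall D, 0 <= psi D) ->
    (\int[P]_w (noise (Z i w) ^+ 2 * psi (masked i w))%:E =
     \int[P]_w (sg (Z i w).1 * psi (masked i w))%:E)%E.
  move=> mpsi psi0.
  apply: (weight_exchange P Z iidZ i forget (fun z => noise z ^+ 2)
    (fun z => sg z.1)) => //.
  - exact: measurable_funX.
  - by apply: measurableT_comp => //; exact: measurable_fst.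
  - have := integrable_fin_num measurableT noise2_integrable.
    rewrite ge0_fin_numE// integral_ge0// => w _.
    by rewrite lee_fin.
  - move=> A mA; under eq_integral do rewrite forget_indic.
    under [RHS]eq_integral do rewrite forget_indic.
    exact/noise_variance/mforget_section.
have E1 : \int[P]_w (noise (Z i w) ^+ 2) = \int[P]_w (sg (Z i w).1).
  have := key (cst 1) (measurable_cst _) (fun=> ler01).
  under eq_integral do rewrite mulr1.
  by under [in X in _ = X -> _]eq_integral do rewrite mulr1; move=> E; congr fine.
have := key (fun D => phi D + K) (measurable_funD mphi (measurable_cst K)).
have phiK0 D : 0 <= phi D + K.
  by have := phiK D; rewrite ler_norml => /andP[]; lra.
move=> /(_ phiK0) E2.
have E3 : \int[P]_w (noise (Z i w) ^+ 2 * phi (masked i w) + K * noise (Z i w) ^+ 2) =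
    \int[P]_w (sg (Z i w).1 * phi (masked i w) + K * sg (Z i w).1).
  transitivity (\int[P]_w (noise (Z i w) ^+ 2 * (phi (masked i w) + K))).
    by apply: eq_Rintegral => w _; ring.
  transitivity (\int[P]_w (sg (Z i w).1 * (phi (masked i w) + K))).
    by congr fine.
  by apply: eq_Rintegral => w _; ring.
move: E3; rewrite !RintegralD ?RintegralZl//; last 2 first.
- exact: (integrableZl measurableT K i4).
- exact: (integrableZl measurableT K i3).
by rewrite E1 => /addIr.
Qed.

(** * Mixtures of nearest-neighbour labels: covariance and variance bounds *)

Variables (I : finType) (c : I -> R) (s : I -> seq nat) (m : nat).
Hypothesis m_gt0 : (0 < m)%N.
Hypothesis s_uniq : forall a, uniq (s a).
Hypothesis s_lt : forall a i, i \in s a -> (i < m)%N.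

Let score1 (z : V) : R := score z.1.

Let mscore1 : measurable_fun setT score1.
Proof. by apply: measurableT_comp => //; exact: measurable_fst. Qed.

Let wt (a : I) (i : nat) (D : nat -> V) : R := (nearest score1 (s a) i D)%:R.

Definition nn_kernel (D : nat -> V) : R :=
  \sum_(a : I) c a * \sum_(i <- s a) (nearest score1 (s a) i D)%:R * (D i).2.

Let wt0 (D : seqspace V) : R := \sum_a c a * ((0%N \in s a)%:R * wt a 0%N D).

(** The kernel in which the regression value at X_0 replaces the label of observation 0; what is
    removed is the noise of that observation times [wt0]. *)
Let rest (D : seqspace V) : R :=
  \sum_a c a * \sum_(i <- s a) wt a i D *
    (if i == 0%N then mt (D 0%N).1 else (D i).2).

Let wt_bound a i D : `|wt a i D| <= 1.
Proof. by rewrite /wt ger0_norm//; case: (nearest _ _ _ _). Qed.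

Let mwt a i : measurable_fun setT (fun D : seqspace V => wt a i D).
Proof. by apply: measurable_boolR; exact: measurable_nearest. Qed.

Let mcoord1 i : measurable_fun setT (fun D : seqspace V => (D i).1).
Proof.
exact: measurableT_comp measurable_fst (@measurable_coordinate _ V i).
Qed.

Let mcoord2 i : measurable_fun setT (fun D : seqspace V => (D i).2).
Proof.
exact: measurableT_comp measurable_snd (@measurable_coordinate _ V i).
Qed.

Let mreindexS (p : nat -> nat) :
  measurable_fun setT (fun D : seqspace V => (fun i => D (p i)) : seqspace V).
Proof. by apply: measurable_seqspaceP => i; exact: measurable_coordinate. Qed.

Let mkernel : measurable_fun setT (nn_kernel : seqspace V -> R).
Proof.
apply: measurable_sum => a; apply: measurable_funM => //.
apply: measurable_sum => i; apply: measurable_funM => //.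
exact: mwt.
Qed.

Let mwt0 : measurable_fun setT wt0.
Proof.
apply: measurable_sum => a; apply: measurable_funM => //.
by apply: measurable_funM => //; exact: mwt.
Qed.

Let mrest : measurable_fun setT rest.
Proof.
apply: measurable_sum => a; apply: measurable_funM => //.
apply: measurable_sum => i; apply: measurable_funM; first exact: mwt.
by case: (i == 0%N) => //; exact: measurableT_comp.
Qed.

Let wt_dep a i D D' : (i < m)%N -> (forall j, (j < m)%N -> D j = D' j) ->
  wt a i D = wt a i D'.
Proof.
move=> im h; rewrite /wt /nearest; congr (nat_of_bool _)%:R.
by apply: eq_in_all => j /s_lt jm; rewrite !h.
Qed.

Let kernel_dep D D' : (forall j, (j < m)%N -> D j = D' j) ->
  nn_kernel D = nn_kernel D'.
Proof.
move=> h; apply: eq_bigr => a _; congr (_ * _); apply: eq_big_seq => i /s_lt im.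
by rewrite -/(wt a i D) -/(wt a i D') (wt_dep _ _ _ _ im h) h.
Qed.

Let wt0_dep D D' : (forall j, (j < m)%N -> D j = D' j) -> wt0 D = wt0 D'.
Proof. by move=> h; apply: eq_bigr => a _; rewrite (wt_dep _ _ _ D'). Qed.

Let rest_dep D D' : (forall j, (j < m)%N -> D j = D' j) -> rest D = rest D'.
Proof.
move=> h; apply: eq_bigr => a _; congr (_ * _); apply: eq_big_seq => i /s_lt im.
by rewrite (wt_dep _ _ _ _ im h) !h.
Qed.

Let kernel_split D : nn_kernel D = noise (D 0%N) * wt0 D + rest D.
Proof.
rewrite /nn_kernel /wt0 /rest mulr_sumr -big_split/=; apply: eq_bigr => a _.
rewrite mulrCA -mulrDr; congr (_ * _).
case: (boolP (0%N \in s a)) => a0; last first.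
  rewrite mul0r mulr0 add0r; apply: eq_big_seq => i ai.
  by case: eqP => // i0; rewrite -i0 ai in a0.
rewrite !(big_rem 0%N a0)/= mul1r addrA; congr (_ + _).
  by rewrite /wt /noise; ring.
apply: eq_big_seq => i; rewrite (mem_rem_uniq _ (s_uniq a)) inE => /andP[i0 _].
by rewrite (negbTE i0).
Qed.

Let wt_masked k a i w (p : nat -> nat) :
  wt a i (fun j => masked k w (p j)) = wt a i (fun j => Z (p j) w).
Proof.
have h j : score1 (masked k w j) = score1 (Z j w).
  by rewrite /masked; case: eqP => // ->.
by rewrite /wt /nearest; congr (nat_of_bool _)%:R; apply: eq_all => j; rewrite !h.
Qed.

Let wt0_masked w (p : nat -> nat) :
  wt0 (fun j => masked 0 w (p j)) = wt0 (fun j => Z (p j) w).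
Proof. by apply: eq_bigr => a _; rewrite wt_masked. Qed.

(** Along [block m b], observation 0 occurs at position 0 only, and there [rest] reads the covariate
    but not the label. *)
Let rest_masked w b :
  rest (fun j => masked 0 w (block m b j)) = rest (fun j => Z (block m b j) w).
Proof.
apply: eq_bigr => a _; congr (_ * _); apply: eq_bigr => i _.
by rewrite wt_masked; case: i => [|i] //; rewrite blockS.
Qed.

Let square_integrable_label i : square_integrable P (fun w => (Z i w).2).
Proof.
have -> : (fun w => (Z i w).2) = fun w => noise (Z i w) + mt (Z i w).1 * 1.
  by apply/funext => w; rewrite /noise; ring.
apply: square_integrableD => //.
apply: (square_integrable_bounded_mul P M) => //.
  exact: measurableT_comp.
exact: square_integrable_cst.
Qed.

Let mwtZ a i (p : nat -> nat) :
  measurable_fun setT (fun w => wt a i (fun j => Z (p j) w)).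
Proof. exact: measurableT_comp (mwt a i) (measurable_reindex P Z iidZ p). Qed.

Let square_integrable_cmul (r : R) u :
  square_integrable P u -> square_integrable P (fun w => r * u w).
Proof. exact: (square_integrable_bounded_mul P `|r|). Qed.

Lemma square_integrable_kernel (p : nat -> nat) :
  square_integrable P (fun w => nn_kernel (fun i => Z (p i) w)).
Proof.
apply: square_integrable_sum => a; apply: square_integrable_cmul.
apply: square_integrable_sum => i.
exact: (square_integrable_bounded_mul P 1 _ _ (mwtZ a i p)).
Qed.

Let square_integrable_rest (p : nat -> nat) :
  square_integrable P (fun w => rest (fun i => Z (p i) w)).
Proof.
apply: square_integrable_sum => a; apply: square_integrable_cmul.
apply: square_integrable_sum => i.
apply: (square_integrable_bounded_mul P 1 _ _ (mwtZ a i p)) => //.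
case: (i == 0%N) => //.
have -> : (fun w => mt (Z (p 0%N) w).1) = fun w => mt (Z (p 0%N) w).1 * 1.
  by apply/funext => w; rewrite mulr1.
apply: (square_integrable_bounded_mul P M) => //.
  exact: measurableT_comp.
exact: square_integrable_cst.
Qed.

Let K0 : R := \sum_a `|c a|.

Let wt0_bound D : `|wt0 D| <= K0.
Proof.
apply: (le_trans (ler_norm_sum _ _ _)); apply: ler_sum => a _.
rewrite normrM ler_piMr// normrM mulr_ile1//.
by rewrite ger0_norm//; case: (_ \in _).
Qed.

Let mwt0Z (p : nat -> nat) :
  measurable_fun setT (fun w => wt0 (fun j => Z (p j) w)).
Proof. exact: measurableT_comp mwt0 (measurable_reindex P Z iidZ p). Qed.

(** The two samples share observation 0 only, and being nearest in each is being nearest in their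
    union. Removing 0 from the second list keeps the union free of duplicates, whence its size
    [size (s a) + size (s a') - 1]. *)
Let nearest_product a a' w : 0%N \in s a -> 0%N \in s a' ->
  wt a 0 (fun i => Z (block m 0 i) w) * wt a' 0 (fun i => Z (block m 1 i) w) =
  (nearest score1 (s a ++ map (block m 1) (rem 0%N (s a'))) 0
     (fun i => Z i w))%:R.
Proof.
move=> a0 a'0; rewrite /wt -natrM mulnb /nearest all_cat; congr ((_ && _)%:R).
  by apply: eq_all => i; rewrite !block0.
rewrite (perm_all _ (perm_to_rem a'0)) /= all_map; apply: eq_in_all => j /=.
rewrite (mem_rem_uniq _ (s_uniq a')) inE => /andP[j0 _].
by case: j j0 => // j _; rewrite blockS.
Qed.

Let wt_product a a' : 0%N \in s a -> 0%N \in s a' ->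
  \int[P]_w (wt a 0 (fun i => Z (block m 0 i) w) *
             wt a' 0 (fun i => Z (block m 1 i) w)) =
  (size (s a) + size (s a')).-1%:R^-1.
Proof.
move=> a0 a'0; under eq_Rintegral do rewrite nearest_product//.
rewrite nearest_probability//.
- rewrite size_cat size_map size_rem//; congr (_%:R^-1).
  by case: (s a') a'0 => //= *; rewrite addnS.
- rewrite cat_uniq s_uniq map_inj_uniq ?rem_uniq//; last exact: block_inj.
  rewrite andbT; apply/hasPn => _ /mapP[j + ->].
  rewrite (mem_rem_uniq _ (s_uniq a')) inE => /andP[j0 _].
  case: j j0 => // j _; apply/negP => /s_lt; rewrite blockS mul1n.
  by move: m_gt0; lia.
- by rewrite mem_cat a0.
Qed.

Let wt0_product :
  \int[P]_w (wt0 (fun i => Z (block m 0 i) w) * wt0 (fun i => Z (block m 1 i) w)) =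
  \sum_(a | 0%N \in s a) \sum_(a' | 0%N \in s a')
    c a * c a' * (size (s a) + size (s a')).-1%:R^-1.
Proof.
have iww a a' : P.-integrable setT (EFin \o (fun w =>
    wt a 0 (fun i => Z (block m 0 i) w) * wt a' 0 (fun i => Z (block m 1 i) w))).
  apply: (bounded_integrable P 1).
    exact: measurable_funM (mwtZ a 0 (block m 0)) (mwtZ a' 0 (block m 1)).
  by move=> w; rewrite normrM mulr_ile1.
pose r a a' : R := c a * c a' * ((0%N \in s a) && (0%N \in s a'))%:R.
have irww a a' : P.-integrable setT (EFin \o (fun w => r a a' *
    (wt a 0 (fun i => Z (block m 0 i) w) * wt a' 0 (fun i => Z (block m 1 i) w)))).
  by have := integrableZl measurableT (r a a') (iww a a'); apply: eq_integrable.
have i1 a := Rintegral_sum P _ (index_enum I) _ (irww a).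
have [_ E] := Rintegral_sum P _ (index_enum I) _ (fun a => (i1 a).1).
transitivity (\int[P]_w (\sum_a \sum_a' r a a' *
    (wt a 0 (fun i => Z (block m 0 i) w) * wt a' 0 (fun i => Z (block m 1 i) w)))).
  apply: eq_Rintegral => w _; rewrite /wt0 big_distrlr /=.
  apply: eq_bigr => a _; apply: eq_bigr => a' _.
  by rewrite /r -mulnb natrM; ring.
rewrite E [RHS]big_mkcond/=; apply: eq_bigr => a _; rewrite (i1 a).2.
case: (boolP (0%N \in s a)) => a0; last first.
  rewrite big1// => a' _; rewrite /r (negbTE a0) /= mulr0.
  by under eq_Rintegral do rewrite mul0r; rewrite Rintegral_cst// mul0r.
rewrite [RHS]big_mkcond/=; apply: eq_bigr => a' _.
case: (boolP (0%N \in s a')) => a'0; last first.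
  rewrite /r (negbTE a'0) andbF mulr0.
  by under eq_Rintegral do rewrite mul0r; rewrite Rintegral_cst// mul0r.
by rewrite RintegralZl// wt_product// /r a0 a'0 mulr1.
Qed.

Let mean : R := \int[P]_w nn_kernel (fun i => Z i w).

Lemma kernel_mean_copy b :
  \int[P]_w nn_kernel (fun i => Z (block m b i) w) = mean.
Proof.
congr fine; apply: (iid_law P Z iidZ m (block m b) nn_kernel) => //.
by move=> i j _ _ /block_inj.
Qed.

(* Writing the kernel as [noise * weight + rest], the terms linear in the noise
   vanish and the covariance of the rests is nonnegative. *)
Lemma kernel_covariance_ge :
  smin * \sum_(a | 0%N \in s a) \sum_(a' | 0%N \in s a')
    c a * c a' * (size (s a) + size (s a')).-1%:R^-1 <=
  \int[P]_w ((nn_kernel (fun i => Z (block m 0 i) w) - mean) *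
             (nn_kernel (fun i => Z (block m 1 i) w) - mean)).
Proof.
pose e w := noise (Z 0%N w).
pose a b w := wt0 (fun i => Z (block m b i) w).
pose r b w := rest (fun i => Z (block m b i) w) - mean.
have Lr b : square_integrable P (r b).
  apply: square_integrableD; first exact: square_integrable_rest.
  exact: square_integrable_cst.
have La b : square_integrable P (a b).
  have -> : a b = fun w => a b w * 1 by apply/funext => w; rewrite mulr1.
  apply: (square_integrable_bounded_mul P K0 _ _ (mwt0Z (block m b))) => //.
  exact: square_integrable_cst.
have Lar b b' : square_integrable P (fun w => a b w * r b' w).
  exact: (square_integrable_bounded_mul P K0 _ _ (mwt0Z (block m b))).
(* The cross terms contain the noise of observation 0 once only, times a function that reads both
   copies from the sequence with that label erased. *)
pose phi b b' (D : seqspace V) :=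
  wt0 (fun i => D (block m b i)) * (rest (fun i => D (block m b' i)) - mean).
have mphi b b' : measurable_fun setT (phi b b').
  apply: measurable_funM; first exact: measurableT_comp mwt0 (mreindexS _).
  apply: measurable_funB => //.
  exact: measurableT_comp mrest (mreindexS _).
have phiE b b' w : phi b b' (masked 0 w) = a b w * r b' w.
  by rewrite /phi wt0_masked rest_masked.
have Iear b b' : P.-integrable setT (EFin \o (fun w => e w * (a b w * r b' w))).
  exact: (square_integrable_mul P e _ (square_integrable_noise 0) (Lar b b')).
have Eear b b' : \int[P]_w (e w * (a b w * r b' w)) = 0.
  under eq_Rintegral do rewrite -phiE.
  apply: noise_orthogonal; first exact: mphi.
  by have := Iear b b'; apply: eq_integrable => // w _; rewrite /= phiE.
have Erest : 0 <= \int[P]_w (r 0%N w * r 1%N w).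
  apply: (copies_covariance_ge0 P Z iidZ m (fun D => rest D - mean)) => //.
  - exact: measurable_funB.
  - by move=> D D' h; rewrite (rest_dep _ _ h).
  - exact: (Lr 0%N).
pose psi (D : seqspace V) :=
  wt0 (fun i => D (block m 0 i)) * wt0 (fun i => D (block m 1 i)).
have mpsi : measurable_fun setT psi.
  by apply: measurable_funM; exact: measurableT_comp mwt0 (mreindexS _).
have psiE w : psi (masked 0 w) = a 0%N w * a 1%N w by rewrite /psi !wt0_masked.
have [Ieaa Eeaa] : P.-integrable setT
      (EFin \o (fun w => e w ^+ 2 * (a 0%N w * a 1%N w))) /\
    \int[P]_w (e w ^+ 2 * (a 0%N w * a 1%N w)) =
    \int[P]_w (sg (Z 0%N w).1 * (a 0%N w * a 1%N w)).
  have psiK D : `|psi D| <= K0 * K0 by rewrite normrM ler_pM.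
  have [I1 E1] := noise_square_bounded 0 (K0 * K0) psi mpsi psiK; split.
    by have := I1; apply: eq_integrable => // w _; rewrite /= psiE.
  under eq_Rintegral do rewrite -psiE.
  by rewrite E1; apply: eq_Rintegral => w _; rewrite psiE.
have msqrt : measurable_fun setT (@Num.sqrt R).
  by apply: continuous_measurable_fun; exact: sqrt_continuous.
have sg_ge0 x : 0 <= sg x - smin by rewrite subr_ge0; case/andP: (sg_bounds x).
have Esg : 0 <= \int[P]_w ((sg (Z 0%N w).1 - smin) * (a 0%N w * a 1%N w)).
  (* Position 0 is the same observation in both copies, so the excess variance splits into two
     square roots, one for each copy. This turns the integral into one of the form E[H H'], whatever
     the sign of [wt0]. *)
  pose H (D : seqspace V) := Num.sqrt (sg (D 0%N).1 - smin) * wt0 D.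
  have mH1 : measurable_fun setT
      (fun D : seqspace V => Num.sqrt (sg (D 0%N).1 - smin)).
    apply: measurableT_comp => //; apply: measurable_funB => //.
    exact: measurableT_comp.
  rewrite (_ : (\int[P]_w _) = \int[P]_w (H (fun i => Z (block m 0 i) w) *
      H (fun i => Z (block m 1 i) w))); last first.
    apply: eq_Rintegral => w _; rewrite /H /= mulrACA -expr2 sqr_sqrtr//.
  apply: (copies_covariance_ge0 P Z iidZ m H) => //.
  - exact: measurable_funM.
  - by move=> D D' h; rewrite /H (wt0_dep _ _ h) h.
  - apply: (square_integrable_bounded_mul P (Num.sqrt (smax - smin))) => //.
      exact: measurableT_comp mH1 (measurable_reindex P Z iidZ (block m 0)).
    move=> w; rewrite ger0_norm ?sqrtr_ge0// ler_sqrt; last first.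
      by have /andP[] := sg_bounds point; lra.
    by rewrite lerD2r; case/andP: (sg_bounds (Z (block m 0 0) w).1).
    exact: (La 0%N).
have Iaa : P.-integrable setT (EFin \o (fun w => a 0%N w * a 1%N w)).
  exact: square_integrable_mul.
have Isgaa : P.-integrable setT (EFin \o (fun w =>
    (sg (Z 0%N w).1 - smin) * (a 0%N w * a 1%N w))).
  apply: (bounded_integrable P ((smax - smin) * (K0 * K0))).
    apply: measurable_funM; last exact: measurable_funM (La 0%N).1 (La 1%N).1.
    by apply: measurable_funB => //; exact: measurableT_comp.
  move=> w; rewrite normrM; apply: ler_pM => //; last first.
    by rewrite normrM; apply: ler_pM => //; exact: wt0_bound.
  rewrite ger0_norm// lerD2r.
  by case/andP: (sg_bounds (Z 0%N w).1).
have Irr : P.-integrable setT (EFin \o (fun w => r 0%N w * r 1%N w)).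
  exact: square_integrable_mul.
have Ismaa : P.-integrable setT (EFin \o (fun w => smin * (a 0%N w * a 1%N w))).
  by have := integrableZl measurableT smin Iaa; apply: eq_integrable.
have I1 : P.-integrable setT (EFin \o (fun w =>
    e w ^+ 2 * (a 0%N w * a 1%N w) + e w * (a 0%N w * r 1%N w))).
  by have := integrableD measurableT Ieaa (Iear 0%N 1%N); apply: eq_integrable.
have I2 : P.-integrable setT (EFin \o (fun w =>
    e w * (a 1%N w * r 0%N w) + r 0%N w * r 1%N w)).
  by have := integrableD measurableT (Iear 1%N 0%N) Irr; apply: eq_integrable.
rewrite (_ : (\int[P]_w (_ * _)) = \int[P]_w (
    (e w ^+ 2 * (a 0%N w * a 1%N w) + e w * (a 0%N w * r 1%N w)) +
    (e w * (a 1%N w * r 0%N w) + r 0%N w * r 1%N w))); last first.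
  by apply: eq_Rintegral => w _; rewrite !kernel_split /a /r /e /=; ring.
rewrite RintegralD// RintegralD// RintegralD// !Eear addr0 add0r Eeaa.
rewrite (_ : (\int[P]_w (sg _ * _)) = \int[P]_w (
    (sg (Z 0%N w).1 - smin) * (a 0%N w * a 1%N w) +
    smin * (a 0%N w * a 1%N w))); last first.
  by apply: eq_Rintegral => w _; ring.
rewrite RintegralD// RintegralZl// wt0_product.
by move: Esg Erest; lra.
Qed.

(** The bound is free of the sample size. The selection depends on the covariates only, so the
    squared noise of the selected observation integrates like [sg], hence at most [smax], and the
    weights sum to at most 1. *)
Let nearest_second_moment a :
  P.-integrable setT (EFin \o (fun w => \sum_(i <- s a)
    wt a i (fun j => Z j w) * (2 * M ^+ 2 + 2 * noise (Z i w) ^+ 2))) /\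
  \int[P]_w (\sum_(i <- s a)
    wt a i (fun j => Z j w) * (2 * M ^+ 2 + 2 * noise (Z i w) ^+ 2)) <=
  2 * M ^+ 2 + 2 * smax.
Proof.
pose W i w := wt a i (fun j => Z j w).
have IW i : P.-integrable setT (EFin \o W i) by exact: nearest_integrable.
have nW i : P.-integrable setT (EFin \o (fun w => noise (Z i w) ^+ 2 * W i w)) /\
    \int[P]_w (noise (Z i w) ^+ 2 * W i w) <= smax * \int[P]_w W i w.
  have E w : wt a i (masked i w) = W i w by exact: (wt_masked i a i w id).
  have [I1 E1] := noise_square_bounded i 1 _ (mwt a i) (wt_bound a i).
  split.
    by have := I1; apply: eq_integrable => // w _; rewrite /= E.
  rewrite (_ : (\int[P]_w _) = \int[P]_w (sg (Z i w).1 * W i w)); last first.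
    transitivity (\int[P]_w (noise (Z i w) ^+ 2 * wt a i (masked i w))).
      by apply: eq_Rintegral => w _; rewrite E.
    by rewrite E1; apply: eq_Rintegral => w _; rewrite E.
  rewrite -RintegralZl//; apply: le_Rintegral => //.
  - apply: (bounded_integrable P smax).
      apply: measurable_funM; last exact: (mwtZ a i id).
      exact: measurableT_comp.
    move=> w; have /andP[l1 l2] := sg_bounds (Z i w).1.
    rewrite normrM ger0_norm; last exact: le_trans l1.
    by apply: le_trans l2; rewrite ler_piMr ?wt_bound//; exact: le_trans l1.
  - by have := integrableZl measurableT smax (IW i); apply: eq_integrable.
  - by move=> w _; rewrite ler_wpM2r//; case/andP: (sg_bounds (Z i w).1).
have IF i : P.-integrable setT (EFin \o (fun w =>
    W i w * (2 * M ^+ 2 + 2 * noise (Z i w) ^+ 2))) /\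
    \int[P]_w (W i w * (2 * M ^+ 2 + 2 * noise (Z i w) ^+ 2)) <=
    (2 * M ^+ 2 + 2 * smax) * \int[P]_w W i w.
  have [I1 le1] := nW i.
  have I2 : P.-integrable setT (EFin \o (fun w => 2 * M ^+ 2 * W i w)).
    by have := integrableZl measurableT (2 * M ^+ 2) (IW i); apply: eq_integrable.
  have I3 : P.-integrable setT (EFin \o (fun w => 2 * (noise (Z i w) ^+ 2 * W i w))).
    by have := integrableZl measurableT 2 I1; apply: eq_integrable.
  have E w : W i w * (2 * M ^+ 2 + 2 * noise (Z i w) ^+ 2) =
      2 * M ^+ 2 * W i w + 2 * (noise (Z i w) ^+ 2 * W i w) by ring.
  split.
    have := integrableD measurableT I2 I3.
    by apply: eq_integrable => // w _; rewrite /= E.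
  under eq_Rintegral do rewrite E.
  by rewrite RintegralD// !RintegralZl//; move: le1; lra.
have [IS ES] := Rintegral_sum P _ (s a) _ (fun i => (IF i).1).
split => //; rewrite ES.
have smax0 : 0 <= smax.
  by case/andP: (sg_bounds point) => h1 /(le_trans h1); exact: le_trans.
have C0 : 0 <= 2 * M ^+ 2 + 2 * smax by rewrite addr_ge0// mulr_ge0// sqr_ge0.
apply: (le_trans (ler_sum _ (fun i _ => (IF i).2))).
rewrite -mulr_sumr ler_piMr//.
have [IWs <-] := Rintegral_sum P _ (s a) _ IW.
have <- : \int[P]_w 1 = 1 :> R.
  rewrite Rintegral_cst// mul1r -[RHS]/(fine 1%E); congr fine.
  exact: probability_setT.
apply: le_Rintegral => //; first exact: finite_measure_integrable_cst.
by move=> w _; exact: sum_nearest_le1.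
Qed.

(** The variance is at most the second moment. Cauchy-Schwarz with the weights [|c a|] reduces it to
    one nearest label at a time, whose square is at most 2 M^2 plus twice the squared noise. *)
Lemma kernel_variance_le :
  \int[P]_w ((nn_kernel (fun i => Z i w) - mean) ^+ 2) <=
  (\sum_a `|c a|) ^+ 2 * (2 * M ^+ 2 + 2 * smax).
Proof.
pose g w := nn_kernel (fun i => Z i w).
pose Q a w := \sum_(i <- s a)
    wt a i (fun j => Z j w) * (2 * M ^+ 2 + 2 * noise (Z i w) ^+ 2).
have Lg : square_integrable P g by exact: (square_integrable_kernel id).
have Ig := square_integrable_integrable P _ Lg.
have Icst (r : R) : P.-integrable setT (EFin \o (fun=> r : R)).
  exact: finite_measure_integrable_cst.
have le1 : \int[P]_w ((g w - mean) ^+ 2) <= \int[P]_w (g w ^+ 2).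
  rewrite (_ : (\int[P]_w ((g w - mean) ^+ 2)) =
      \int[P]_w (g w ^+ 2 + ((- 2 * mean) * g w + mean ^+ 2))); last first.
    by apply: eq_Rintegral => w _; ring.
  have I1 : P.-integrable setT (EFin \o (fun w => - 2 * mean * g w)).
    by have := integrableZl measurableT (- 2 * mean) Ig; apply: eq_integrable.
  have I2 : P.-integrable setT (EFin \o (fun w => - 2 * mean * g w + mean ^+ 2)).
    by have := integrableD measurableT I1 (Icst (mean ^+ 2)); apply: eq_integrable.
  rewrite RintegralD//; last exact: Lg.2.
  rewrite RintegralD// RintegralZl// Rintegral_cst//.
  rewrite (_ : fine (P setT) = 1); last first.
    by rewrite -[RHS]/(fine 1%E); congr fine; exact: probability_setT.
  rewrite (_ : (\int[P]_w g w) = mean)//.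
  by have := sqr_ge0 mean; nra.
apply: (le_trans le1).
have gQ w : g w ^+ 2 <= K0 * \sum_a `|c a| * Q a w.
  pose y a := \sum_(i <- s a) wt a i (fun j => Z j w) * (Z i w).2.
  have yQ a : y a ^+ 2 <= Q a w.
    rewrite /y sum_nearest_sqr//; apply: ler_sum => i _.
    rewrite ler_wpM2l//.
    have -> : (Z i w).2 = noise (Z i w) + mt (Z i w).1 by rewrite /noise; ring.
    have : mt (Z i w).1 ^+ 2 <= M ^+ 2.
      rewrite -[X in X <= _]real_normK ?num_real// ler_pXn2r ?nnegrE//.
      by rewrite (le_trans _ (mtM (Z i w).1)).
    by have := sqr_ge0 (noise (Z i w) - mt (Z i w).1); nra.
  have -> : g w = \sum_a c a * y a by [].
  apply: (@le_trans _ _ (K0 * \sum_a `|c a| * y a ^+ 2)); last first.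
    rewrite ler_wpM2l ?sumr_ge0//; apply: ler_sum => a _.
    by rewrite ler_wpM2l.
  apply: (@le_trans _ _ ((\sum_a `|c a| * `|y a|) ^+ 2)).
    rewrite -[X in X <= _]real_normK ?num_real// ler_pXn2r ?nnegrE// ?sumr_ge0//.
    apply: (le_trans (ler_norm_sum _ _ _)); apply: ler_sum => a _.
    by rewrite normrM.
  rewrite expr2 /K0 !big_distrlr /=.
  have symm : \sum_a \sum_b `|c a| * (`|c b| * y b ^+ 2) =
      \sum_a \sum_b `|c b| * (`|c a| * y a ^+ 2).
    by rewrite exchange_big.
  (* Cauchy-Schwarz by symmetrisation: once the double sum is symmetric in [a] and [b], it remains
     to compare |y_a| |y_b| with the mean of the two squares. *)
  have half : \sum_a \sum_b `|c a| * (`|c b| * y b ^+ 2) =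
      \sum_a \sum_b `|c a| * `|c b| * ((y a ^+ 2 + y b ^+ 2) / 2).
    rewrite -[LHS](@mulfK _ 2)// mulrDr mulr1 {2}symm -big_split/= mulr_suml.
    apply: eq_bigr => a _; rewrite -big_split/= mulr_suml.
    by apply: eq_bigr => b _; ring.
  rewrite half; apply: ler_sum => a _; apply: ler_sum => b _.
  rewrite mulrACA ler_wpM2l ?mulr_ge0//.
  rewrite -[in leRHS](real_normK (num_real (y a))).
  rewrite -[in leRHS](real_normK (num_real (y b))).
  by have := sqr_ge0 (`|y a| - `|y b|); nra.
have IcQ a : P.-integrable setT (EFin \o (fun w => `|c a| * Q a w)).
  have := integrableZl measurableT `|c a| (nearest_second_moment a).1.
  exact: eq_integrable.
have [IS ES] := Rintegral_sum P _ (index_enum I) _ IcQ.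
apply: (@le_trans _ _ (\int[P]_w (K0 * \sum_a `|c a| * Q a w))).
  apply: le_Rintegral => //; first exact: Lg.2.
  by have := integrableZl measurableT K0 IS; apply: eq_integrable.
rewrite RintegralZl// ES expr2 -mulrA ler_wpM2l ?sumr_ge0//.
rewrite mulr_suml; apply: ler_sum => a _.
rewrite RintegralZl//; last exact: (nearest_second_moment a).1.
by rewrite ler_wpM2l//; exact: (nearest_second_moment a).2.
Qed.

End regression.

(** * Measurability and null spheres in Euclidean space *)

Section euclidean_measurability.
Context {R : realType} {k : nat}.

Let box (q : 'rV[rat]_k) (n : nat) : set (k.-tuple R) :=
  [set t | forall i, `|tnth t i - ratr (q 0 i)| < n.+1%:R^-1].

Let measurable_box q n : measurable (box q n).
Proof.
have -> : box q n = \bigcap_(i in [set: 'I_k])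
    ((fun t : k.-tuple R => tnth t i) @^-1` ball (ratr (q 0 i) : R) n.+1%:R^-1).
  apply/seteqP; split => t h i; first by move=> _; rewrite /= /ball/= distrC; exact: h.
  by have := h i I; rewrite /= /ball/= distrC.
apply: fin_bigcap_measurable => [|i _]; first exact: finite_finset.
rewrite -[X in measurable X]setTI; apply: measurable_tnth => //.
exact: measurable_ball.
Qed.

(** Links the topology of row vectors to the product sigma-algebra of tuples: an open set is the
    union of the countably many boxes with rational centre and radius 1/(n+1) that it contains. *)
Lemma open_rowt_measurable (U : set 'rV[R]_k) :
  open U -> measurable (@rowt R k @^-1` U).
Proof.
move=> oU; pose F (p : 'rV[rat]_k * nat) : set (k.-tuple R) :=
  if `[< box p.1 p.2 `<=` @rowt R k @^-1` U >] then box p.1 p.2 else set0.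
have -> : @rowt R k @^-1` U = \bigcup_p F p.
  apply/seteqP; split => [t Ut|t [p _]]; last first.
    by rewrite /F; case: asboolP => // h; exact: h.
  have /nbhs_ballP[e /= e0 eU] : nbhs (rowt t) U by exact: open_nbhs_nbhs.
  have [n ne] : exists n : nat, n.+1%:R^-1 < e / 2.
    have e20 : 0 < e / 2 by rewrite divr_gt0.
    exists (Num.truncn (e / 2)^-1).
    rewrite invf_plt ?posrE//; exact: truncnS_gt.
  have n0 : 0 < n.+1%:R^-1 :> R by rewrite invr_gt0.
  have /choice[q qP] : forall i, exists q : rat, `|tnth t i - ratr q| < n.+1%:R^-1.
    move=> i; have [|q] := @rat_in_itvoo R (tnth t i) (tnth t i + n.+1%:R^-1).
      by rewrite ltrDl.
    rewrite in_itv/= => /andP[q1 q2]; exists q.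
    by rewrite distrC gtr0_norm ?subr_gt0// ltrBlDl.
  exists (\row_i q i, n) => //; rewrite /F.
  have tq : box (\row_i q i) n t by move=> i; rewrite mxE.
  case: asboolP => // -[]; move=> u uq; apply: eU; split => // i j.
  rewrite /ball/= !mxE; have := uq j; have := tq j => /=.
  set a := tnth t j; set b := tnth u j; set r := ratr _ => h1 h2.
  rewrite (_ : a - b = (a - r) - (b - r)); last by ring.
  apply: (le_lt_trans (ler_normB _ _)); rewrite (splitr e).
  by rewrite ltrD// (lt_trans _ ne).
apply: countable_bigcupT_measurable => [|p].
  exact: countableP.
by rewrite /F; case: asboolP => // _; exact: measurable_box.
Qed.

Lemma closed_rowt_measurable (K : set 'rV[R]_k) :
  closed K -> measurable (@rowt R k @^-1` K).
Proof.
move=> cK; rewrite -[X in measurable X]setCK; apply: measurableC.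
exact: (open_rowt_measurable (~` K) (closed_openC cK)).
Qed.

(** The set where the function is at least [a] is closed in [K], hence closed, up to the open
    complement of [K], which is added exactly when [a <= r]. *)
Lemma within_continuous_measurable (K : set 'rV[R]_k) (h : 'rV[R]_k -> R) (r : R) :
  closed K -> {within K, continuous h} ->
  measurable_fun setT
    (fun t : k.-tuple R => if rowt t \in K then h (rowt t) else r).
Proof.
move=> cK ch.
refine (@measurability _ _ _ _ setT _ (@RGenCInfty.G R) (@RGenCInfty.measurableE R) _).
move=> _ [_ [a ->] <-]; rewrite setTI.
have [V cV VK] : exists2 V : set 'rV[R]_k, closed V &
    V `&` K = h @^-1` `[a, +oo[%classic `&` K.
  apply/closed_subspaceP.
  have /continuous_closedP := ch.
  by apply; exact: interval_closed.
have -> : (fun t : k.-tuple R => if rowt t \in K then h (rowt t) else r)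
      @^-1` `[a, +oo[%classic =
    @rowt R k @^-1` (V `&` K) `|`
    (if a <= r then @rowt R k @^-1` (~` K) else set0).
  apply/seteqP; split => t /=; rewrite in_itv/= andbT.
    case: ifPn => [tK aht|tK ar]; [left|right].
      have /(congr1 (fun S => S (rowt t))) := VK; rewrite /= in_itv/= andbT => ->.
      by split => //; exact: set_mem.
    by rewrite ar /=; move: tK; rewrite notin_setE.
  move=> [tVK|].
    have := tVK; rewrite -[_ /\ _]/((V `&` K) (rowt t)) VK /= in_itv/= andbT.
    by move=> [aht tK]; rewrite mem_set.
  by case: ifP => // ar /= tK; rewrite memNset.
apply: measurableU.
  exact: (closed_rowt_measurable (V `&` K) (closedI cV cK)).
case: ifP => // _; exact: (open_rowt_measurable (~` K) (closed_openC cK)).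
Qed.

Lemma measurable_sqdist (x : 'rV[R]_k) : measurable_fun setT (@sqdist R k x).
Proof.
apply: measurable_sum => i; apply: measurable_funX; apply: measurable_funB => //.
exact: measurable_tnth.
Qed.

End euclidean_measurability.

Lemma integral_two_points {R : realType} (a b : R) (g : R -> \bar R) :
  (forall t, t != a -> t != b -> g t = 0%E) ->
  (\int[@lebesgue_measure R]_t g t = 0)%E.
Proof.
move=> g0; have mab : measurable [set a; b] by exact: measurableU.
transitivity (\int[@lebesgue_measure R]_(t in [set a; b]) g t)%E.
  rewrite [RHS]integral_mkcond; apply: eq_integral => t _; rewrite patchE.
  case: ifPn => //; rewrite notin_setE => h.
  by apply: g0; apply/eqP => e; apply: h; [left|right].
apply: null_set_integral => //.
  by apply/measurable_funU => //; split; exact: measurable_fun_set1.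
have : (lebesgue_measure [set a; b] <=
    lebesgue_measure [set a] + lebesgue_measure [set b])%E.
  exact: measureU2.
rewrite !lebesgue_measure_set1 adde0 => h.
by apply/eqP; rewrite eq_le h measure_ge0.
Qed.

(* Only the innermost integral matters: for fixed first coordinates a sphere
   meets the line of the last coordinate in at most two points. *)
Lemma iter_int_sphere {R : realType} (n : nat) (y : 'I_n.+1 -> R) (r : R)
    (g : n.+1.-tuple R -> \bar R) :
  (forall t, \sum_(i < n.+1) (tnth t i - y i) ^+ 2 != r -> g t = 0%E) ->
  iter_int g = 0%E.
Proof.
elim: n y r g => [|n IHn] y r g g0.
  apply: (integral_two_points (y ord0 + Num.sqrt r) (y ord0 - Num.sqrt r)) => t t1 t2.
  apply: g0; rewrite big_ord1 tnth0; apply/eqP => tr.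
  have : (t - y ord0) ^+ 2 == (Num.sqrt r) ^+ 2.
    by rewrite sqr_sqrtr -?tr ?sqr_ge0.
  rewrite eqf_sqr => /orP[] /eqP e.
    by move: t1; rewrite -e addrC subrK eqxx.
  by move: t2; rewrite -e addrC subrK eqxx.
apply: integral0_eq => t _.
have := IHn (fun i => y (lift ord0 i)) (r - (t - y ord0) ^+ 2)
  (fun u => g (cons_tuple t u)).
apply => u h; apply: g0; rewrite big_ord_recl tnth0; apply: contra_neq h => <-.
rewrite addrC addKr; apply: eq_bigr => i _; by rewrite tnthS.
Qed.

Lemma nn_subE {R : realType} {k : nat} (x : 'rV[R]_k) (m : nat) (A : {set 'I_m})
    (D : nat -> k.-tuple R * R) :
  nn_sub x A D = \sum_(i <- [seq val i | i <- enum A])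
    (nearest (fun z : k.-tuple R * R => sqdist x z.1)
       [seq val i | i <- enum A] i D)%:R * (D i).2.
Proof.
rewrite big_map big_enum /= /nn_sub; apply: eq_bigr => i iA.
rewrite /nearest all_map.
have -> : [forall j in A, (j != i) ==> (sqdist x (D i).1 < sqdist x (D j).1)] =
    all (preim val (fun j : nat => (j != i) ==>
      (sqdist x (D i).1 < sqdist x (D j).1))) (enum A).
  apply/forall_inP/allP => h j jA; first by apply: h; rewrite mem_enum in jA.
  by apply: (h j); rewrite mem_enum.
by case: ifP => _; rewrite ?mul1r ?mul0r.
Qed.

(** * Mixtures of DNN kernels *)

(** Pascal's rule: of all subsets of size [p.+1], those avoiding [ord0] number ['C(m, p.+1)]. *)
Lemma card_sets_containing (m p : nat) :
  #|[pred A : {set 'I_m.+1} | (ord0 \in A) && (#|A| == p.+1)]| = 'C(m, p).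
Proof.
have := cards_draws (~: [set ord0 : 'I_m.+1])%SET p.+1.
rewrite cardsC1 card_ord /= => E0.
have := card_draws 'I_m.+1 p.+1; rewrite card_ord binS -E0.
rewrite -(cardsID [set A : {set 'I_m.+1} | ord0 \in A]%SET).
rewrite addnC (_ : #|_ :\: _| = #|[set A : {set 'I_m.+1} |
  A \subset ~: [set ord0] & #|A| == p.+1]%SET|); last first.
  apply: eq_card => A; rewrite !inE finset.subsetC finset.sub1set inE.
  by case: (ord0 \in A).
move=> /eqP; rewrite eqn_add2l => /eqP <-.
by apply: eq_card => A; rewrite !inE andbC.
Qed.

Lemma sum_sets_containing {R : realType} (m q : nat) (r : R) : (0 < q)%N ->
  \sum_(A : {set 'I_m.+1} | ord0 \in A) (#|A| == q)%:R * r = 'C(m, q.-1)%:R * r.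
Proof.
case: q => // q _; rewrite -mulr_suml -card_sets_containing; congr (_ * _).
rewrite -natr_sum; congr (_%:R).
rewrite -sum1_card [LHS]big_mkcond [RHS]big_mkcond/=; apply: eq_bigr => A _.
by rewrite inE; case: (ord0 \in A); case: (#|A| == q.+1).
Qed.

(** Coefficients over all subsets of a sample of size [m.+1]: mass [a] spread uniformly on those of
    size [p], mass [b] on the full set. TDNN is [a = w1], [b = 1 - w1]; DNN is [a = 0], [b = 1]. *)
Definition mixed_coef {R : realType} (m p : nat) (a b : R) (A : {set 'I_m.+1}) : R :=
  a / 'C(m.+1, p)%:R * (#|A| == p)%:R + b * (#|A| == m.+1)%:R.

(** The summand depends on the two sizes only, so counting the sets that contain [ord0] leaves the
    size pairs formed from [p] and [m.+1]. A proportion [p / m.+1] of the subsets of size [p]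
    contains [ord0], hence the factor of [a]. *)
Lemma mixed_coef_form {R : realType} (m p : nat) (a b : R) :
  (0 < p <= m.+1)%N ->
  \sum_(A : {set 'I_m.+1} | ord0 \in A) \sum_(A' : {set 'I_m.+1} | ord0 \in A')
     mixed_coef m p a b A * mixed_coef m p a b A' * (#|A| + #|A'|).-1%:R^-1 =
  (a * (p%:R / m.+1%:R)) ^+ 2 / (p + p).-1%:R +
  2 * (a * (p%:R / m.+1%:R) * b / (p + m.+1).-1%:R) +
  b ^+ 2 / (m.+1 + m.+1).-1%:R.
Proof.
move=> /andP[p0 pm].
pose S q q' : R :=
  \sum_(A : {set 'I_m.+1} | ord0 \in A) \sum_(A' : {set 'I_m.+1} | ord0 \in A')
    (#|A| == q)%:R * ((#|A'| == q')%:R * (q + q').-1%:R^-1).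
have SE q q' : (0 < q)%N -> (0 < q')%N ->
    S q q' = 'C(m, q.-1)%:R * ('C(m, q'.-1)%:R * (q + q').-1%:R^-1).
  move=> q0 q'0; rewrite -(@sum_sets_containing R m q _ q0).
  apply: eq_bigr => A _; rewrite -mulr_sumr; congr (_ * _).
  exact: sum_sets_containing.
have binE : 'C(m, p.-1)%:R / 'C(m.+1, p)%:R = p%:R / m.+1%:R :> R.
  have C0 : 'C(m.+1, p)%:R != 0 :> R by rewrite pnatr_eq0 -lt0n bin_gt0.
  have m0 : m.+1%:R != 0 :> R by rewrite pnatr_eq0.
  have := mul_bin_diag m.+1 p.-1; rewrite prednK// => /(congr1 (fun n => n%:R : R)).
  rewrite !natrM => h; apply: (mulIf C0); apply: (mulfI m0).
  by rewrite mulfVK// h; field.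
set u := a / 'C(m.+1, p)%:R.
transitivity (u ^+ 2 * S p p + (u * b * S p m.+1 +
    (u * b * S m.+1 p + b ^+ 2 * S m.+1 m.+1))).
  rewrite /S !mulr_sumr -!big_split; apply: eq_bigr => A _ /=.
  rewrite !mulr_sumr -!big_split; apply: eq_bigr => A' _ /=.
  rewrite /mixed_coef -/u.
  have K q q' : (#|A| == q)%:R * ((#|A'| == q')%:R * (q + q').-1%:R^-1) =
      (#|A| == q)%:R * (#|A'| == q')%:R * (#|A| + #|A'|).-1%:R^-1 :> R.
    case: (eqVneq #|A| q) => [->|_]; last by rewrite !mul0r.
    by case: (eqVneq #|A'| q') => [->|_]; rewrite ?mul1r ?mul0r ?mulr0.
  by rewrite !K; ring.
rewrite !SE// !(addnC m.+1 p) [m.+1.-1]/= binn -binE /u.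
by field; rewrite ?pnatr_eq0 -?lt0n ?bin_gt0 ?pm//; lia.
Qed.

Lemma mixed_coef_norm {R : realType} (m p : nat) (a b : R) : (p <= m.+1)%N ->
  \sum_(A : {set 'I_m.+1}) `|mixed_coef m p a b A| <= `|a| + `|b|.
Proof.
move=> pm.
have cnt q (r : R) : \sum_(A : {set 'I_m.+1}) r * (#|A| == q)%:R = r * 'C(m.+1, q)%:R.
  rewrite -mulr_sumr -[in RHS](card_ord m.+1) -card_draws -sum1_card natr_sum.
  rewrite [in RHS]big_mkcond/=; congr (_ * _); apply: eq_bigr => A _.
  by rewrite inE; case: ifP.
have C0 : 'C(m.+1, p)%:R != 0 :> R by rewrite pnatr_eq0 -lt0n bin_gt0.
apply: (@le_trans _ _ (\sum_(A : {set 'I_m.+1})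
   (`|a| / 'C(m.+1, p)%:R * (#|A| == p)%:R + `|b| * (#|A| == m.+1)%:R))).
  apply: ler_sum => A _; apply: (le_trans (ler_normD _ _)).
  by rewrite !normrM normfV !normr_nat.
by rewrite big_split/= !cnt binn mulr1 mulfVK.
Qed.

(** Completing the square in [al] leaves [be ^+ 2] times 1/q - 4p/(p + q)^2, which is the stated
    remainder. It holds for [al] and [be] of opposite signs, the case of TDNN. *)
Lemma quadratic_form_ge {R : realType} (al be p q : R) : 0 < p -> 0 < q ->
  be ^+ 2 * (q - p) ^+ 2 / (q * (p + q) ^+ 2) <=
  al ^+ 2 / p + 2 * (al * be / ((p + q) / 2)) + be ^+ 2 / q.
Proof.
move=> p0 q0; have pq0 : 0 < p + q by rewrite addr_gt0.
rewrite -subr_ge0.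
rewrite (_ : _ - _ = p^-1 * (al + 2 * p * be / (p + q)) ^+ 2).
  by rewrite mulr_ge0 ?sqr_ge0// invr_ge0 ltW.
by field; rewrite !gt_eqF.
Qed.

Lemma predn_addR {R : realType} (a b : nat) : (0 < a)%N ->
  (a + b).-1%:R = a%:R + b%:R - 1 :> R.
Proof.
case: a => // a _.
by rewrite addSn succnK natrD -natr1 addrAC addrK.
Qed.

(** Here [t], [S], [w] stand for s1, s2, w1, and p = 2t - 1, q = 2S - 1. The constant comes from q -
    p >= 2cS, q <= 2S, p + q <= 4S and 1 - w >= 1: S (2cS)^2 / (2S (4S)^2) = c^2 / 8. *)
Lemma tdnn_form_ge {R : realType} (t S w c : R) :
  1 <= t -> t <= (1 - c) * S -> 1 <= S -> 0 < c -> w < 0 ->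
  c ^+ 2 / 8 <= S * ((w * (t / S)) ^+ 2 / (t + t - 1) +
    2 * (w * (t / S) * (1 - w) / (t + S - 1)) + (1 - w) ^+ 2 / (S + S - 1)).
Proof.
move=> t1 tS S1 c0 w0.
have S0 : 0 < S by lra.
have cS : 0 < c * S by rewrite mulr_gt0.
pose p := t + t - 1; pose q := S + S - 1.
have -> : t + S - 1 = (p + q) / 2 by rewrite /p /q; field.
rewrite -/p -/q.
have p_gt0 : 0 < p by rewrite /p; lra.
have q_gt0 : 0 < q by rewrite /q; lra.
have pq0 : 0 < p + q by rewrite addr_gt0.
apply: (le_trans _ (ler_wpM2l (ltW S0)
  (quadratic_form_ge (w * (t / S)) (1 - w) p q p_gt0 q_gt0))).
have gap : 2 * (c * S) <= q - p by rewrite /p /q; lra.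
have pq4 : p + q <= 4 * S by rewrite /p /q; lra.
have q2 : q <= 2 * S by rewrite /q; lra.
have den : q * (p + q) ^+ 2 <= 2 * S * (4 * S) ^+ 2.
  apply: ler_pM => //; [exact: ltW|exact: sqr_ge0|].
  by rewrite ler_pXn2r ?nnegrE//; lra.
have num : (2 * (c * S)) ^+ 2 <= (1 - w) ^+ 2 * (q - p) ^+ 2.
  rewrite -[leLHS]mul1r; apply: ler_pM => //; first exact: sqr_ge0.
    by rewrite -[leLHS](expr1n _ 2) ler_pXn2r ?nnegrE//; lra.
  by rewrite ler_pXn2r ?nnegrE//; lra.
have den0 : 0 < q * (p + q) ^+ 2 by rewrite mulr_gt0// exprn_gt0.
rewrite mulrA ler_pdivlMr//.
apply: (@le_trans _ _ (c ^+ 2 / 8 * (2 * S * (4 * S) ^+ 2))).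
  by rewrite ler_wpM2l// divr_ge0// sqr_ge0.
rewrite (_ : c ^+ 2 / 8 * _ = S * (2 * (c * S)) ^+ 2).
  by rewrite ler_wpM2l// ltW.
by field.
Qed.

Lemma integral_eq_off_null {d} {T : measurableType d} {R : realType}
    (P : probability T R) (G : set T) (f g : T -> R) :
  measurable G -> P G = 1%E ->
  measurable_fun setT f -> measurable_fun setT g ->
  (forall w, G w -> f w = g w) ->
  (\int[P]_w (f w)%:E = \int[P]_w (g w)%:E)%E.
Proof.
move=> mG PG mf mg fg.
apply: ae_eq_integral => //; [exact/measurable_EFinP|exact/measurable_EFinP|].
exists (~` G); split; first exact: measurableC.
  by apply: (etrans (@probability_setC _ _ _ P _ mG)); rewrite PG subee.
move=> w /= h Gw; apply: h => _.
by rewrite fg.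
Qed.

(** * Bounds on zeta and the dominance ratio *)

Section zeta.
Context {d dV} {T : measurableType d} {V : measurableType dV} {R : realType}.
Variables (P : probability T R) (Z : nat -> T -> V) (g : (nat -> V) -> R).

Lemma zeta_mE : zeta_m P Z g =
  \int[P]_w ((g (fun i => Z i w) - \int[P]_w g (fun i => Z i w)) ^+ 2).
Proof.
rewrite /zeta_m /variance covariance.unlock !expectation.unlock.
by congr fine; apply: eq_integral => w _; rewrite expr2.
Qed.

Lemma zeta_1E m : (0 < m)%N -> zeta_1 P Z g m =
  \int[P]_w ((g (fun i => Z (block m 0 i) w) - \int[P]_w g (fun i => Z i w)) *
    (g (fun i => Z (block m 1 i) w) - \int[P]_w g (fun i => Z (block m 1 i) w))).
Proof.
move=> m0; rewrite /zeta_1.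
have E1 w : (fun i => if i == 0%N then Z 0%N w else Z (m + i - 1)%N w) =
    (fun i => Z (block m 1 i) w).
  apply/funext => -[|i] //; rewrite blockS /=; congr (Z _ w); lia.
have E0 w : (fun i => Z (block m 0 i) w) = (fun i => Z i w).
  by apply/funext => i; rewrite block0.
rewrite (_ : (fun w => g (fun i => if i == 0%N then _ else _)) =
  fun w => g (fun i => Z (block m 1 i) w)); last first.
  by apply/funext => w; exact: congr1 (E1 w).
rewrite covariance.unlock !expectation.unlock.
rewrite /Rintegral; congr fine; apply: eq_integral => w _.
by rewrite /= E0.
Qed.

End zeta.

Lemma hajek_ratio_cvg0 {R : realType} (s : nat -> nat) (zm z1 : nat -> R) (C c0 : R) :
  0 < c0 -> (forall n, 0 < s n)%N -> (forall n, 0 <= zm n <= C) ->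
  (forall n, c0 <= (s n)%:R * z1 n) ->
  (fun n => (s n)%:R / n%:R : R) @ \oo --> (0 : R) ->
  (fun n => (s n)%:R / n%:R * (zm n / ((s n)%:R * z1 n) - 1) : R) @ \oo --> (0 : R).
Proof.
move=> c00 s0 zmC z1c sn0.
have snK : (fun n => (s n)%:R / n%:R * (C / c0 + 1) : R) @ \oo --> (0 : R).
  by rewrite -[X in _ --> X](mul0r (C / c0 + 1)); apply: cvgMl.
have snNK : (fun n => - ((s n)%:R / n%:R * (C / c0 + 1)) : R) @ \oo --> (0 : R).
  by rewrite -[X in _ --> X]oppr0; apply: cvgN.
apply: (squeeze_cvgr _ snNK snK); near=> n.
rewrite -ler_norml normrM ger0_norm ?divr_ge0// ler_wpM2l ?divr_ge0//.
have /andP[z0 zC] := zmC n; have sz := lt_le_trans c00 (z1c n).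
apply: (le_trans (ler_normB _ _)); rewrite normr1 lerD2r.
rewrite ger0_norm; last by rewrite divr_ge0// ltW.
apply: ler_pM => //; first by rewrite invr_ge0 ltW.
by rewrite lef_pV2 ?posrE.
Unshelve. all: by end_near. Qed.

Section hajek_dominance.
Context {R : realType} {k : nat} {dT : measure_display} {T : measurableType dT}.
Variables (P : probability T R) (Z : nat -> T -> k.-tuple R * R) (x : 'rV[R]_k).
Variables (mt sg : k.-tuple R -> R) (M smin smax : R).
Hypothesis iidZ : iid P Z.
Hypothesis mmt : measurable_fun setT mt.
Hypothesis msg : measurable_fun setT sg.
Hypothesis mtM : forall t, `|mt t| <= M.
Hypothesis smin_gt0 : 0 < smin.
Hypothesis sg_bounds : forall t, smin <= sg t <= smax.
Hypothesis noise2_integrable :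
  P.-integrable setT (EFin \o (fun w => noise mt (Z 0%N w) ^+ 2)).
Hypothesis noise_centered : forall A : set (k.-tuple R), measurable A ->
  (\int[P]_w (noise mt (Z 0%N w) * \1_A (Z 0%N w).1)%:E = 0)%E.
Hypothesis noise_variance : forall A : set (k.-tuple R), measurable A ->
  (\int[P]_w (noise mt (Z 0%N w) ^+ 2 * \1_A (Z 0%N w).1)%:E =
   \int[P]_w (sg (Z 0%N w).1 * \1_A (Z 0%N w).1)%:E)%E.
Hypothesis sqdist_no_atom :
  forall r, P ((fun w => sqdist x (Z 0%N w).1) @^-1` [set r]) = 0%E.

Definition mixed_kernel (m p : nat) (a b : R) (D : nat -> k.-tuple R * R) : R :=
  a * ('C(m.+1, p)%:R^-1 * \sum_(A : {set 'I_m.+1} | #|A| == p) nn_sub x A D) +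
  b * dnn_kernel x m.+1 D.

Let idx (m : nat) (A : {set 'I_m.+1}) : seq nat := [seq val i | i <- enum A].

Let idx_uniq m (A : {set 'I_m.+1}) : uniq (idx m A).
Proof. by rewrite map_inj_uniq ?enum_uniq//; exact: val_inj. Qed.

Let idx_lt m (A : {set 'I_m.+1}) i : i \in idx m A -> (i < m.+1)%N.
Proof. by move=> /mapP[j _ ->]; exact: ltn_ord. Qed.

Let size_idx m (A : {set 'I_m.+1}) : size (idx m A) = #|A|.
Proof. by rewrite size_map -cardE. Qed.

Let idx0 m (A : {set 'I_m.+1}) : (0%N \in idx m A) = (ord0 \in A).
Proof.
by rewrite -[0%N]/(val (ord0 : 'I_m.+1)) mem_map ?mem_enum//; exact: val_inj.
Qed.

Let mixed_kernelE m p a b : mixed_kernel m p a b =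
  nn_kernel (sqdist x) _ (mixed_coef m p a b) (idx m).
Proof.
apply/funext => D; rewrite /mixed_kernel /nn_kernel.
under [RHS]eq_bigr do rewrite -nn_subE mulrDl.
rewrite big_split/= mulrA mulr_sumr [in LHS]big_mkcond/=; congr (_ + _).
  by apply: eq_bigr => A _; case: ifP => _; rewrite ?mulr1 ?mulr0 ?mul0r.
rewrite (bigD1 [set: 'I_m.+1]%SET)//= cardsT card_ord eqxx mulr1.
rewrite big1 ?addr0// => A AT.
rewrite (_ : (#|A| == m.+1) = false) ?mulr0 ?mul0r//.
apply/negbTE; apply: contra AT => /eqP AE.
by rewrite eqEcard finset.subsetT cardsT card_ord AE leqnn.
Qed.

Let C : R := 2 * M ^+ 2 + 2 * smax.

Let C_ge0 : 0 <= C.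
Proof.
have /andP[h1 h2] := sg_bounds point.
by rewrite addr_ge0// mulr_ge0 ?sqr_ge0// (le_trans _ h2)// (le_trans _ h1)// ltW.
Qed.

Lemma zeta_m_mixed_kernel m p a b : (p <= m.+1)%N ->
  0 <= zeta_m P Z (mixed_kernel m p a b) <= (`|a| + `|b|) ^+ 2 * C.
Proof.
move=> pm; rewrite zeta_mE; apply/andP; split.
  by apply: Rintegral_ge0 => w _; exact: sqr_ge0.
rewrite mixed_kernelE.
have := kernel_variance_le P Z (sqdist x) mt sg M smin smax iidZ
  (measurable_sqdist x) mmt msg mtM (ltW smin_gt0) sg_bounds noise2_integrable
  noise_variance _ (mixed_coef m p a b) (idx m) (idx_uniq m).
move=> /le_trans; apply; rewrite ler_wpM2r//.
rewrite ler_pXn2r ?nnegrE ?addr_ge0 ?sumr_ge0//.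
exact: mixed_coef_norm.
Qed.

Lemma zeta_1_mixed_kernel m p a b : (0 < p <= m.+1)%N ->
  smin * ((a * (p%:R / m.+1%:R)) ^+ 2 / (p + p).-1%:R +
    2 * (a * (p%:R / m.+1%:R) * b / (p + m.+1).-1%:R) +
    b ^+ 2 / (m.+1 + m.+1).-1%:R) <=
  zeta_1 P Z (mixed_kernel m p a b) m.+1.
Proof.
move=> pm; rewrite zeta_1E// mixed_kernelE.
rewrite (kernel_mean_copy P Z (sqdist x) iidZ (measurable_sqdist x) _
  (mixed_coef m p a b) (idx m) m.+1 (idx_lt m)).
have := kernel_covariance_ge P Z (sqdist x) mt sg M smin smax iidZ
  (measurable_sqdist x) mmt msg mtM (ltW smin_gt0) sg_bounds noise2_integrable
  noise_centered noise_variance sqdist_no_atom _ (mixed_coef m p a b) (idx m)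
  m.+1 (ltn0Sn m) (idx_uniq m) (idx_lt m).
apply: le_trans; rewrite -mixed_coef_form//.
rewrite le_eqVlt; apply/orP; left; apply/eqP; congr (_ * _).
apply: eq_big => [A|A _]; first by rewrite idx0.
apply: eq_big => [A'|A' _]; first by rewrite idx0.
by rewrite !size_idx.
Qed.

Lemma dnn_kernelE m : dnn_kernel x m.+1 = mixed_kernel m m.+1 0 1.
Proof. by apply/funext => D; rewrite /mixed_kernel mul0r add0r mul1r. Qed.

Lemma dnn_hajek (s : nat -> nat) : (forall n, 0 < s n)%N ->
  (fun n => (s n)%:R / n%:R : R) @ \oo --> (0 : R) ->
  (fun n => (s n)%:R / n%:R *
    (zeta_m P Z (dnn_kernel x (s n)) /
      ((s n)%:R * zeta_1 P Z (dnn_kernel x (s n)) (s n)) - 1) : R)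
  @ \oo --> (0 : R).
Proof.
move=> s0 sn0.
(* For DNN the quadratic form is 1/(2s - 1), and s/(2s - 1) >= 1/2. *)
apply: (hajek_ratio_cvg0 s _ _ C (smin / 2)) => //; first by rewrite divr_gt0.
- move=> n; case: (s n) (s0 n) => // m _; rewrite dnn_kernelE.
  have := zeta_m_mixed_kernel m m.+1 0 1 (leqnn _).
  by rewrite normr0 normr1 add0r expr1n mul1r.
- move=> n; case: (s n) (s0 n) => // m _; rewrite dnn_kernelE.
  have := zeta_1_mixed_kernel m m.+1 0 1 (leqnn _).
  rewrite !mul0r expr0n/= mul0r mulr0 !add0r expr1n mul1r => h.
  rewrite -(ler_pM2l (ltr0Sn R m)) in h; apply: le_trans h.
  rewrite mulrCA ler_pM2l// ler_pdivlMr ?ltr0n; last lia.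
  rewrite mulrC ler_pdivrMr// -natrM ler_nat; lia.
Qed.

Lemma tdnn_hajek (s1 s2 : nat -> nat) (c : R) : (0 < k)%N ->
  (forall n, 0 < s1 n < s2 n)%N ->
  (fun n => (s2 n)%:R / n%:R : R) @ \oo --> (0 : R) ->
  0 < c < 1 / 2 ->
  (forall n, c <= (s1 n)%:R / (s2 n)%:R <= 1 - c) ->
  (fun n => (s2 n)%:R / n%:R *
    (zeta_m P Z (tdnn_kernel x (s1 n) (s2 n)) /
      ((s2 n)%:R * zeta_1 P Z (tdnn_kernel x (s1 n) (s2 n)) (s2 n)) - 1) : R)
  @ \oo --> (0 : R).
Proof.
move=> k0 s12 sn0 /andP[c0 c2] ratio.
pose e : R := 2 / k%:R.
have e0 : 0 < e by rewrite divr_gt0 ?ltr0n.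
(* Since s1/s2 <= 1 - c, the power (s1/s2)^(-2/k) is at least [lam > 1]. Hence w1 is negative and
   stays above [- (lam - 1)^-1], uniformly in n. *)
pose lam : R := ((1 - c) `^ e)^-1.
have c1 : 0 < 1 - c by lra.
have lam1 : 1 < lam.
  have lt1 : (1 - c) `^ e < 1.
    have := @gt0_ltr_powR R e e0 (1 - c) 1; rewrite powR1; apply.
    - by rewrite nnegrE ltW.
    - by rewrite nnegrE.
    - by lra.
  by rewrite /lam invf_gt1// powR_gt0.
have w1 n : - (lam - 1)^-1 <= tdnn_w1 R k (s1 n) (s2 n) < 0.
  have /andP[r1 r2] := ratio n; set r := _ / _ in r1 r2 *.
  have r0 : 0 < r by exact: lt_le_trans r1.
  have lamr : lam <= r `^ (- e).
    rewrite powRN lef_pV2 ?posrE ?powR_gt0//.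
    by apply: ge0_ler_powR => //; rewrite ?nnegrE; lra.
  rewrite /tdnn_w1 -/r -/e -(opprB (r `^ (- e)) 1) invrN lerN2 oppr_lt0.
  rewrite invr_gt0 lef_pV2 ?posrE; lra.
have tE n m : s2 n = m.+1 -> tdnn_kernel x (s1 n) (s2 n) =
    mixed_kernel m (s1 n) (tdnn_w1 R k (s1 n) (s2 n)) (1 - tdnn_w1 R k (s1 n) (s2 n)).
  by move=> sm; apply/funext => D; rewrite /tdnn_kernel /mixed_kernel sm.
pose B := (lam - 1)^-1; have B0 : 0 < B by rewrite invr_gt0; lra.
(* [B] bounds |w1| and [1 + B] bounds |1 - w1|; the lower constant is that of [tdnn_form_ge]. *)
apply: (hajek_ratio_cvg0 s2 _ _ ((B + (1 + B)) ^+ 2 * C) (smin * (c ^+ 2 / 8))) => //.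
- by rewrite mulr_gt0// divr_gt0// exprn_gt0.
- by move=> n; case/andP: (s12 n) => ? /(leq_ltn_trans _); apply.
- move=> n; have /andP[l1 l2] := w1 n; have /andP[p0 pm] := s12 n.
  case E : (s2 n) pm => [//|m] pm; rewrite -E (tE n m E).
  have /andP[-> /=] := zeta_m_mixed_kernel m (s1 n) (tdnn_w1 R k (s1 n) (s2 n))
    (1 - tdnn_w1 R k (s1 n) (s2 n)) (ltnW pm).
  move=> /le_trans; apply; rewrite ler_wpM2r// ler_pXn2r ?nnegrE ?addr_ge0//; try lra.
  rewrite ltr0_norm// gtr0_norm; last lra.
  by move: l1; rewrite -/B; lra.
- move=> n; have /andP[l1 l2] := w1 n; have /andP[p0 pm] := s12 n.
  have /andP[r1 r2] := ratio n.
  case E : (s2 n) pm => [//|m] pm; rewrite -E (tE n m E).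
  set w := tdnn_w1 R k (s1 n) (s2 n).
  have := zeta_1_mixed_kernel m (s1 n) w (1 - w).
  rewrite p0 ltnW// => /(_ isT) h; rewrite E.
  rewrite -(ler_pM2l (ltr0Sn R m)) in h; apply: le_trans h.
  rewrite [leRHS]mulrCA ler_pM2l// !predn_addR//.
  apply: tdnn_form_ge => //; first by rewrite ler1n.
    by move: r2; rewrite E ler_pdivrMr ?ltr0n.
  by rewrite ler1n.
Qed.

End hajek_dominance.

(** * From the model assumptions to globally bounded regression functions *)

Lemma iter_int_sphere_pos {R : realType} (n : nat) (y : 'I_n -> R) (r : R)
    (g : n.-tuple R -> \bar R) : (0 < n)%N ->
  (forall t, \sum_(i < n) (tnth t i - y i) ^+ 2 != r -> g t = 0%E) ->
  iter_int g = 0%E.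
Proof. by case: n y g => // n y g _; exact: iter_int_sphere. Qed.

Theorem theorem3
  (R : realType) (k : nat) (dT : measure_display) (T : measurableType dT)
  (P : probability T R) (Z : nat -> T -> k.-tuple R * R)
  (Xset : set 'rV[R]_k) (f mu sigma2 : 'rV[R]_k -> R)
  (fl fu sigbar : R) (x : 'rV[R]_k) (s1 s2 : nat -> nat) :
  (0 < k)%N ->
  (* data: i.i.d. observations Z_i = (X_i, Y_i) *)
  iid P Z ->
  (* covariate space: compact subset of R^k *)
  compact Xset ->
  (* X has density f (w.r.t. Lebesgue measure on R^k), supported on Xset *)
  (forall A : set (k.-tuple R), measurable A ->
     P ((fun w => (Z 0%N w).1) @^-1` A) =
     iter_int (fun t => (\1_(A `&` (@rowt R k @^-1` Xset)) t * f (rowt t))%:E)) ->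
  0 < fl -> (forall v, Xset v -> fl <= f v <= fu) ->
  (* smoothness of f and mu *)
  (exists U, open U /\ Xset `<=` U /\ C4_on U f /\ C4_on U mu) ->
  bounded_d234_on Xset f -> bounded_d234_on Xset mu ->
  (* mu in L^2(Xset, phi) *)
  P.-integrable setT (fun w => ((mu (rowt (Z 0%N w).1)) ^+ 2)%:E) ->
  (* Y = mu(X) + eps with E[eps | X] = 0 and Var(eps | X) = sigma2(X) *)
  P.-integrable setT (fun w => ((Z 0%N w).2 - mu (rowt (Z 0%N w).1))%:E) ->
  P.-integrable setT (fun w => (((Z 0%N w).2 - mu (rowt (Z 0%N w).1)) ^+ 2)%:E) ->
  (forall A : set (k.-tuple R), measurable A ->
     ('E_P[(fun w => ((Z 0%N w).2 - mu (rowt (Z 0%N w).1)) * \1_A (Z 0%N w).1)%R])%E = 0%E) ->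
  (forall A : set (k.-tuple R), measurable A ->
     ('E_P[(fun w => ((Z 0%N w).2 - mu (rowt (Z 0%N w).1)) ^+ 2 * \1_A (Z 0%N w).1)%R])%E =
     ('E_P[(fun w => sigma2 (rowt (Z 0%N w).1) * \1_A (Z 0%N w).1)%R])%E) ->
  (* conditions on sigma2 *)
  {within Xset, continuous sigma2} ->
  (forall v, Xset v -> 0 < sigma2 v <= sigbar) ->
  P.-integrable setT (fun w => ((sigma2 (rowt (Z 0%N w).1)) ^+ 2)%:E) ->
  (* the query point *)
  Xset x ->
  (* subsampling scales *)
  (forall n, 0 < s1 n < s2 n)%N ->
  (fun n => (s2 n)%:R / n%:R : R) @ \oo --> (0 : R) ->
  (fun n => (s1 n)%:R : R) @ \oo --> +oo ->
  (fun n => (s2 n)%:R : R) @ \oo --> +oo ->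
  (exists c : R, 0 < c < 1 / 2 /\
     forall n, c <= (s1 n)%:R / (s2 n)%:R <= 1 - c) ->
  (* asymptotic Hajek dominance for DNN (s = s1 and s = s2) and TDNN *)
  [/\ (fun n => (s1 n)%:R / n%:R *
          (zeta_m P Z (dnn_kernel x (s1 n)) /
             ((s1 n)%:R * zeta_1 P Z (dnn_kernel x (s1 n)) (s1 n)) - 1) : R)
        @ \oo --> (0 : R),
      (fun n => (s2 n)%:R / n%:R *
          (zeta_m P Z (dnn_kernel x (s2 n)) /
             ((s2 n)%:R * zeta_1 P Z (dnn_kernel x (s2 n)) (s2 n)) - 1) : R)
        @ \oo --> (0 : R) &
      (fun n => (s2 n)%:R / n%:R *
          (zeta_m P Z (tdnn_kernel x (s1 n) (s2 n)) /
             ((s2 n)%:R * zeta_1 P Z (tdnn_kernel x (s1 n) (s2 n)) (s2 n)) - 1) : R)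
        @ \oo --> (0 : R)].
Proof.
move=> k0 iidZ cK dens fl0 fb [U [oU [KU [Cf Cmu]]]] _ _ _ ieps ieps2 Eeps Eeps2.
move=> csig sigb _ Kx s12 s2n s1y s2y [c [c01 ratio]].
have clK : closed Xset by exact: compact_closed (@norm_hausdorff _ _) cK.
pose X w := (Z 0%N w).1.
have mZ0 : measurable_fun setT (Z 0%N) by case: iidZ.
have mX : measurable_fun setT X by exact: measurableT_comp measurable_fst mZ0.
pose K := @rowt R k @^-1` Xset.
have mK : measurable K by exact: closed_rowt_measurable.
pose G := X @^-1` K.
have mG : measurable G by rewrite -[X in measurable X]setTI; exact: mX.
(* The density formula carries the indicator of [Xset], so [K] and [setT] have the same iterated
   integral. *)
have PG : P G = 1%E.
  rewrite -[RHS](@probability_setT _ _ _ P) -(preimage_setT X).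
  rewrite (dens K mK) (dens setT measurableT).
  by congr iter_int; apply/funext => t; rewrite -/K setIid setTI.
have no_atom r : P ((fun w => sqdist x (Z 0%N w).1) @^-1` [set r]) = 0%E.
  have mA : measurable (sqdist x @^-1` [set r]).
    by rewrite -[X in measurable X]setTI; exact: measurable_sqdist.
  rewrite (dens _ mA).
  apply: (iter_int_sphere_pos k (fun i => x 0 i) r) => // t tr.
  rewrite indicE memNset ?mul0r// => -[/= e _].
  by move: tr; rewrite -e eqxx.
have cmu : {within Xset, continuous mu}.
  apply: continuous_in_subspaceT => v /set_mem Kv.
  by have [] := Cmu [::] isT v (KU v Kv).
have K0 : Xset !=set0 by exists x.
have [va Ka amin] := EVT_min_rV K0 cK cmu.
have [vb Kb bmax] := EVT_max_rV K0 cK cmu.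
have [vc Kc cmin] := EVT_min_rV K0 cK csig.
pose M := `|mu va| + `|mu vb|; pose smin := sigma2 vc.
pose mt t := if rowt t \in Xset then mu (@rowt R k t) else 0.
(* [sigma2] attains its minimum [smin] on the compact [Xset], so [smin > 0]; using it as the value
   off [Xset] keeps the lower bound valid everywhere. *)
pose sg t := if rowt t \in Xset then sigma2 (@rowt R k t) else smin.
have mmt : measurable_fun setT mt by exact: within_continuous_measurable.
have msg : measurable_fun setT sg by exact: within_continuous_measurable.
have mtM t : `|mt t| <= M.
  rewrite /mt; case: ifP => tK; last by rewrite normr0 addr_ge0.
  have := amin _ tK; have := bmax _ tK; rewrite /M.
  have := ler_norm (mu vb); have := ler_normr (mu va); have := normr_ge0 (mu va).
  have := normr_ge0 (mu vb); have := ler_norm (- mu va); rewrite normrN ler_norml.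
  by move=> *; apply/andP; split; lra.
have smin0 : 0 < smin by case/andP: (sigb _ (set_mem Kc)).
have sgb t : smin <= sg t <= sigbar.
  rewrite /sg; case: ifP => tK.
    by rewrite cmin//=; case/andP: (sigb _ (set_mem tK)).
  by rewrite lexx /=; case/andP: (sigb _ (set_mem Kc)).
pose eps w := (Z 0%N w).2 - mu (rowt (X w)).
have meps : measurable_fun setT eps.
  by apply/measurable_EFinP; exact: measurable_int ieps.
have mnoise : measurable_fun setT (fun w => noise mt (Z 0%N w)).
  apply: measurable_funB; first exact: measurableT_comp measurable_snd mZ0.
  exact: measurableT_comp.
have noiseE w : G w -> noise mt (Z 0%N w) = eps w.
  by move=> Gw; rewrite /noise /eps /mt mem_set.
have m1 (A : set (k.-tuple R)) : measurable A ->
    measurable_fun setT (fun w => \1_A (X w) : R).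
  move=> mA; have mi : measurable_fun setT (\1_A : _ -> R).
    exact: measurable_indic.
  exact: measurableT_comp mi mX.
have noise2 : P.-integrable setT (EFin \o (fun w => noise mt (Z 0%N w) ^+ 2)).
  have /integrableP[_ fin] := ieps2; apply/integrableP; split.
    by apply/measurable_EFinP; exact: measurable_funX.
  move: fin; rewrite /= (integral_eq_off_null P G
    (fun w => `|noise mt (Z 0%N w) ^+ 2|) (fun w => `|eps w ^+ 2|))//.
  - by apply: measurableT_comp => //; exact: measurable_funX.
  - by apply: measurableT_comp => //; exact: measurable_funX.
  - by move=> w Gw; rewrite noiseE.
have noise_centered (A : set (k.-tuple R)) : measurable A ->
    (\int[P]_w (noise mt (Z 0%N w) * \1_A (Z 0%N w).1)%:E = 0)%E.
  move=> mA; have := Eeps A mA; rewrite expectation.unlock => <-.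
  apply: (integral_eq_off_null P G) => //.
  - by apply: measurable_funM => //; exact: m1.
  - by apply: measurable_funM => //; exact: m1.
  - by move=> w Gw; rewrite noiseE.
have noise_variance (A : set (k.-tuple R)) : measurable A ->
    (\int[P]_w (noise mt (Z 0%N w) ^+ 2 * \1_A (Z 0%N w).1)%:E =
     \int[P]_w (sg (Z 0%N w).1 * \1_A (Z 0%N w).1)%:E)%E.
  (* The variance hypothesis is applied to [A] cut down to [K]: off [Xset], [sigma2] is
     unconstrained and may differ from [sg], while the indicator of [K] makes both integrands equal
     pointwise. *)
  move=> mA; have mAK : measurable (A `&` K) by exact: measurableI.
  have indicK w : G w -> \1_(A `&` K) (X w) = \1_A (X w) :> R.
    by move=> Gw; rewrite !indicE in_setI (mem_set (Gw : K (X w))) andbT.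
  transitivity (\int[P]_w (eps w ^+ 2 * \1_(A `&` K) (X w))%:E)%E.
    apply: (integral_eq_off_null P G) => //.
    - by apply: measurable_funM; [exact: measurable_funX|exact: m1].
    - by apply: measurable_funM; [exact: measurable_funX|exact: m1].
    - by move=> w Gw; rewrite noiseE// indicK.
  have := Eeps2 _ mAK; rewrite expectation.unlock => ->.
  transitivity (\int[P]_w (sg (X w) * \1_(A `&` K) (X w))%:E)%E.
    apply: eq_integral => w _; congr _%:E; rewrite indicE.
    case: (boolP (X w \in A `&` K)); last by rewrite !mulr0.
    by rewrite inE => -[_ Kw]; rewrite /sg mem_set.
  apply: (integral_eq_off_null P G) => //.
  - by apply: measurable_funM; [exact: measurableT_comp|exact: m1].
  - by apply: measurable_funM; [exact: measurableT_comp|exact: m1].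
  - by move=> w Gw; rewrite indicK.
have s1_gt0 n : (0 < s1 n)%N by case/andP: (s12 n).
have s2_gt0 n : (0 < s2 n)%N by case/andP: (s12 n) => _; exact: leq_ltn_trans.
have s1n : (fun n => (s1 n)%:R / n%:R : R) @ \oo --> (0 : R).
  apply: (squeeze_cvgr _ (cvg_cst 0) s2n); near=> n.
  rewrite divr_ge0//= ler_wpM2r ?invr_ge0// ler_nat.
  by case/andP: (s12 n) => _ /ltnW.
split.
- exact: (dnn_hajek P Z x mt sg M smin sigbar).
- exact: (dnn_hajek P Z x mt sg M smin sigbar).
- exact: (tdnn_hajek P Z x mt sg M smin sigbar _ _ _ _ _ _ _ _ _ _ s1 s2 c).
Unshelve. all: by end_near. Qed.
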